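(* Let $X$ be a smooth projective complex curve of genus $\ge 2$ with an action of the quaternion group $Q_8=\{\pm1,\pm i,\pm j,\pm ij\}$, $i^2=j^2=(ij)^2=-1$ (so $Q_8\subset\mathrm{Aut}(X)$), and let $Y=X/Q_8$. For a subgroup $M\subset Q_8$ write $X_M=X/M$. Then the isotypical decomposition of $JX$ is $$JX\sim JY\times P(X_{\langle i\rangle}/Y)\times P(X_{\langle j\rangle}/Y)\times P(X_{\langle ij\rangle}/Y)\times P(X/X_{\langle -1\rangle}),$$ that is, the factors on the right are, in this order, isogenous to the isotypical components $A_U, A_{U_i},A_{U_j},A_{U_{ij}},A_W$ of $JX$.
   Context: $\sim$ means ''isogenous to''. For a finite morphism $f:X'\to Y'$ of smooth projective curves, $P(X'/Y'):=\ker(\mathrm{Nm} f:JX'\to JY')^{\circ}$ (connected component of $0$ of the kernel of the norm map). The irreducible $\mathbb{Q}$-representations of $Q_8$ are: the trivial one $U$; the one-dimensional ones $U_i$ ($\pm i\mapsto 1$, $\pm j,\pm ij\mapsto -1$), $U_j$ ($\pm j\mapsto 1$, $\pm i,\pm ij\mapsto -1$), $U_{ij}$ ($\pm ij\mapsto 1$, $\pm i,\pm j\mapsto -1$), all with $\pm1\mapsto 1$; and $W=\mathbb{H}_{\mathbb{Q}}$, the quaternion algebra $(-1,-1)$ over $\mathbb{Q}$, with $W\otimes_{\mathbb{Q}}\mathbb{C}\simeq V^2$ for the two-dimensional irreducible complex representation $V$. The action of a group $G$ on $X$ induces $\rho:\mathbb{Q}[G]\to\mathrm{End}_{\mathbb{Q}}(JX)$.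 For an irreducible $\mathbb{Q}$-representation $R$ of $G$ let $e_R$ be the unit element of the corresponding simple factor of $\mathbb{Q}[G]$ (a central idempotent). The isotypical component is $A_R:=\mathrm{Im}(\rho(m e_R))\subseteq JX$ for any positive integer $m$ with $m e_R\in\mathbb{Z}[G]$, and the addition map $\prod_R A_R\to JX$ is an isogeny, the isotypical decomposition. *)

(* Defs.v *)
From HB Require Import structures.
From mathcomp Require Import all_boot all_order all_algebra all_fingroup.
From mathcomp Require Import mxrepresentation complex.
From mathcomp Require Import all_classical all_reals all_analysis.

Set Implicit Arguments.
Unset Strict Implicit.
Unset Printing Implicit Defensive.

Import Order.TTheory GRing.Theory Num.Theory.
Import numFieldNormedType.Exports.
Local Open Scope classical_set_scope.
Local Open Scope ring_scope.

(* Declared as a numFieldType so that the norm topology of R[i] is found. *)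
Definition C (R : realType) : numFieldType := R[i].
Arguments C : simpl never.

Section InChart.
Context {R : realType} {T : topologicalType}.

(* (U, phi), where only the values of phi on U matter *)
Definition chart : Type := set T * (T -> C R).

(* f = g \o phi near x, with g holomorphic near phi(x) *)
Definition hol_in_chart (E : normedModType (C R)) (c : chart) (f : T -> E)
    (x : T) : Prop :=
  exists2 g : C R -> E,
    \forall z \near c.2 x, differentiable g z &
    \forall y \near x, f y = g (c.2 y).

(* dF = a * dphi at x *)
Definition is_coef (c : chart) (F : T -> C R) (x : T) (a : C R) : Prop :=
  exists2 g : C R -> C R,
    is_derive (c.2 x) 1 g a &
    \forall y \near x, F y = g (c.2 y).

End InChart.
Arguments chart R T : clear implicits.

(* Smooth projective complex curves, as compact connected Riemann surfaces *)
Record curve (R : realType) : Type := Curve {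
  point_of :> topologicalType;
  atlas : set (chart R point_of);
  curve_neq0 : [set: point_of] !=set0;
  curve_hausdorff : hausdorff_space point_of;
  curve_compact : compact [set: point_of];
  curve_connected : connected [set: point_of];
  atlas_cover : forall x, exists2 c, atlas c & c.1 x;
  atlas_homeo : forall c, atlas c ->
    [/\ open c.1, set_inj c.1 c.2, {in c.1, continuous c.2} &
        forall B, open B -> B `<=` c.1 -> open (c.2 @` B)];
  atlas_compat : forall c d, atlas c -> atlas d ->
    forall x, c.1 x -> d.1 x -> hol_in_chart c (d.2 : _ -> C R) x
}.

Section Curves.
Context {R : realType}.
Implicit Types X Y : curve R.

(* f is holomorphic in a neighbourhood of x *)
Definition hol_at X (E : normedModType (C R)) (f : X -> E) (x : X) : Prop :=
  exists2 c, atlas c & c.1 x /\ hol_in_chart c f x.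

Definition hol_map X Y (f : X -> Y) : Prop :=
  continuous f /\
  forall d, atlas d -> forall x, d.1 (f x) -> hol_at (d.2 \o f : X -> C R) x.

(* A family of coefficients: in the chart c = (U, phi), the form is
   (w c) * dphi on U.  Values outside the atlas, or outside U, are junk. *)
Definition form X : Type := chart R X -> X -> C R.

(* w = dF near x *)
Definition is_differential X (F : X -> C R) (w : form X) (x : X) : Prop :=
  \forall y \near x, forall c, atlas c -> c.1 y -> is_coef c F y (w c y).

(* The sheaf of holomorphic 1-forms is the image of d : O -> Omega^1; this
   contains the transformation rule between charts. *)
Definition hol_form X (w : form X) : Prop :=
  forall x, exists F : X -> C R, is_differential F w x.

(* g = dim H^0(X, Omega^1) *)
Definition genus X (g : nat) : Prop :=
  exists2 b : 'I_g -> form X, (forall k, hol_form (b k)) &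
    forall w, hol_form w -> exists! a : 'rV[C R]_g,
      forall c y, atlas c -> c.1 y -> w c y = \sum_k a 0 k * b k c y.

End Curves.

(* Abelian varieties are handled as complex tori, abelian subvarieties as
   sets of points of a torus.  0 -> lattice -> C^n -> T -> 0; the three topological conditions say that
   the kernel is a discrete subgroup, that T has the quotient topology and
   that the kernel has full rank. *)
Record torus (R : realType) : Type := Torus {
  torus_sort :> topologicalZmodType;
  tdim : nat;
  texp : 'rV[C R]_tdim -> torus_sort;
  texpD : {morph texp : u v / u + v};
  texp_surj : forall x, exists v, texp v = x;
  texp_discrete : \forall v \near (0 : 'rV[C R]_tdim), texp v = 0 -> v = 0;
  texp_continuous : continuous texp;
  texp_open : forall B, open B -> open (texp @` B);
  torus_compact : compact [set: torus_sort]
}.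
Arguments texp {R t}.


Section ProductGroup.
Variables S T : topologicalZmodType.

Lemma prod_sub_continuous :
  continuous (fun x : (S * T) * (S * T) => x.1 - x.2).
Proof.
move=> [/= xy1 xy2] /= U /= [] [A B] /= [nA nB] nU.
have [/= A0 [A01 A02] nA1] := @sub_continuous S (xy1.1, xy2.1) _ nA.
have [/= B0 [B01 B02] nB1] := @sub_continuous T (xy1.2, xy2.2) _ nB.
exists ([set xy | A0.1 xy.1 /\ B0.1 xy.2], [set xy | A0.2 xy.1 /\ B0.2 xy.2]).
  by split; [exists (A0.1, B0.1)|exists (A0.2, B0.2)].
move=> [[x1 y1][x2 y2]] /= [] [] a1 b1 [] a2 b2.
by apply: nU; split; [exact: (nA1 (x1, x2))|exact: (nB1 (y1, y2))].
Qed.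

(* S * T itself is only a canonical topologicalZmodType for tvsTypes *)
Definition prod_group : Type := (S * T)%type.

HB.instance Definition _ := GRing.Zmodule.copy prod_group (S * T)%type.
HB.instance Definition _ := Topological.copy prod_group (S * T)%type.
HB.instance Definition _ := PreTopologicalNmodule_isTopologicalZmodule.Build
  prod_group prod_sub_continuous.

End ProductGroup.

Section ProductTorus.
Context {R : realType} (S T : torus R).

Definition prod_texp (v : 'rV[C R]_(tdim S + tdim T)) : S * T :=
  (texp (lsubmx v), texp (rsubmx v)).

Lemma prod_texpD : {morph prod_texp : u v / u + v}.
Proof. by move=> u v; rewrite /prod_texp !linearD !texpD. Qed.

Lemma prod_texp_surj x : exists v, prod_texp v = x.
Proof.
case: x => x y; have [u <-] := texp_surj x; have [v <-] := texp_surj y.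
by exists (row_mx u v); rewrite /prod_texp row_mxKl row_mxKr.
Qed.

Lemma lsubmx_continuous m n : continuous (@lsubmx (C R) 1 m n).
Proof.
move=> v U /(nbhs_ballP (lsubmx v))[e e0 eU].
by apply/nbhs_ballP; exists e => // w [_ vw]; apply: eU; split => // k l;
   rewrite !mxE; exact: vw.
Qed.

Lemma rsubmx_continuous m n : continuous (@rsubmx (C R) 1 m n).
Proof.
move=> v U /(nbhs_ballP (rsubmx v))[e e0 eU].
by apply/nbhs_ballP; exists e => // w [_ vw]; apply: eU; split => // k l;
   rewrite !mxE; exact: vw.
Qed.

Lemma prod_texp_discrete :
  \forall v \near (0 : 'rV[C R]_(tdim S + tdim T)), prod_texp v = 0 -> v = 0.
Proof.
have hl := @lsubmx_continuous (tdim S) (tdim T) 0.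
have hr := @rsubmx_continuous (tdim S) (tdim T) 0.
rewrite /continuous_at linear0 in hl; rewrite /continuous_at linear0 in hr.
near=> v => -[v1 v2]; rewrite -(hsubmxK v).
have -> : lsubmx v = 0.
  by move: v1; near: v; exact: (hl _ (@texp_discrete R S)).
have -> : rsubmx v = 0.
  by move: v2; near: v; exact: (hr _ (@texp_discrete R T)).
by rewrite row_mx0.
Unshelve. all: by end_near. Qed.

Lemma prod_texp_continuous : continuous prod_texp.
Proof.
move=> v.
have hS : texp (lsubmx w) @[w --> v] --> texp (lsubmx v) .
  exact: cvg_comp _ _ (@lsubmx_continuous _ _ v) (@texp_continuous R S _).
have hT : texp (rsubmx w) @[w --> v] --> texp (rsubmx v) .
  exact: cvg_comp _ _ (@rsubmx_continuous _ _ v) (@texp_continuous R T _).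
by move=> U /(cvg_pair hS hT).
Qed.

Lemma prod_texp_open B : open B -> open (prod_texp @` B).
Proof.
rewrite !openE => Bo _ [v Bv <-]; have /nbhs_ballP[e e0 eB] := Bo v Bv.
have oS : open (texp @` ball (lsubmx v) e : set S).
  by apply: texp_open; exact: ball_open.
have oT : open (texp @` ball (rsubmx v) e : set T).
  by apply: texp_open; exact: ball_open.
exists (texp @` ball (lsubmx v) e : set S, texp @` ball (rsubmx v) e : set T).
  split; apply: open_nbhs_nbhs; split => //.
    by exists (lsubmx v) => //; exact: ballxx.
  by exists (rsubmx v) => //; exact: ballxx.
move=> [x y] /= [[u [_ vu] <-] [w [_ vw] <-]]; exists (row_mx u w).
  apply: eB; split=> // k l; rewrite -[v]hsubmxK.
  by case: (split_ordP l) => l' ->; rewrite ?row_mxEl ?row_mxEr.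
by rewrite /prod_texp row_mxKl row_mxKr.
Qed.

Lemma prod_torus_compact : compact [set: S * T].
Proof.
rewrite -setXTT; apply: compact_setX; exact: torus_compact.
Qed.

Definition prod_torus : torus R :=
  @Torus R (prod_group S T) _ _ prod_texpD prod_texp_surj prod_texp_discrete prod_texp_continuous
    prod_texp_open prod_torus_compact.

End ProductTorus.

Section Isogenies.
Context {R : realType}.
Implicit Types S T : torus R.

(* Holomorphic homomorphism from the subtorus A of S to T: the restriction of
   h to A lifts, near every point, to a holomorphic map of the ambient
   vector spaces. *)
Definition torus_hom S T (A : set S) (h : S -> T) : Prop :=
  {in A &, {morph h : x y / x + y}} /\
  forall v : 'rV_(tdim S), A (texp v) ->
    exists2 g : 'rV[C R]_(tdim S) -> 'rV[C R]_(tdim T),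
      \forall w \near v, differentiable g w &
      \forall w \near v, A (texp w) -> h (texp w) = texp (g w).

Definition isogeny S T (A : set S) (B : set T) (h : S -> T) : Prop :=
  [/\ torus_hom A h, h @` A = B & finite_set [set x | A x /\ h x = 0]].

Definition isogenous S T (A : set S) (B : set T) : Prop :=
  exists h : S -> T, isogeny A B h.

End Isogenies.

Section Jacobians.
Context {R : realType}.
Implicit Types X Y : curve R.

Section AbelJacobi.
Context X (T : torus R) (alpha : X -> T).

(* f is a holomorphic local lift of alpha to the universal cover *)
Definition local_lift (f : X -> 'rV[C R]_(tdim T)) (x : X) : Prop :=
  hol_at f x /\ \forall y \near x, alpha y = texp (f y).

(* w = alpha^* l, where l : 'cV is seen as a translation invariant 1-form *)
Definition is_pullback (l : 'cV[C R]_(tdim T)) (w : form X) : Prop :=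
  forall x, exists2 f, local_lift f x &
    is_differential (fun y => (f y *m l) 0 0 : C R) w x.

(* v = (int_gamma alpha^* dz_k)_k for some loop gamma: since these forms are
   the differentials of the coordinates of a lift of alpha \o gamma, the
   integral is the difference between the end points of that lift. *)
Definition is_period (v : 'rV[C R]_(tdim T)) : Prop :=
  exists (gamma : R -> X) (lift : R -> 'rV[C R]_(tdim T)),
    [/\ {within `[0, 1], continuous gamma} /\ gamma 0 = gamma 1,
        {within `[0, 1], continuous lift},
        forall t, `[0, 1]%classic t -> alpha (gamma t) = texp (lift t) &
        v = lift 1 - lift 0].

End AbelJacobi.

(* JX = H^0(X, Omega^1)^* / H_1(X, Z), presented by its Abel-Jacobi map alpha
   (with an arbitrary base point): the pullback of invariant forms identifies
   the dual of the tangent space of JX with H^0(X, Omega^1), and the lattice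
   is then the group of periods. *)
Record jacobian_torus X : Type := JacobianTorus {
  jac_torus :> torus R;
  abel_jacobi : X -> jac_torus;
  abel_jacobi_hol : forall x, exists f, local_lift abel_jacobi f x;
  jac_forms : forall w, hol_form w -> exists! l, is_pullback abel_jacobi l w;
  jac_periods : forall v, texp v = 0 <-> is_period abel_jacobi v
}.

(* On divisor classes of degree 0, Nm f is [p - q] |-> [f p - f q]. *)
Definition is_norm_map X Y (JX : jacobian_torus X) (JY : jacobian_torus Y) (f : X -> Y)
    (N : JX -> JY) : Prop :=
  torus_hom setT N /\
  forall p q, N (abel_jacobi JX p - abel_jacobi JX q) =
    abel_jacobi JY (f p) - abel_jacobi JY (f q).

(* the unique such N when f is holomorphic *)
Definition Nm X Y (JX : jacobian_torus X) (JY : jacobian_torus Y) (f : X -> Y) : JX -> JY :=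
  xget (fun=> 0) [set N | is_norm_map f N].

Arguments Nm {X Y} JX JY f.

Definition Prym X Y (JX : jacobian_torus X) (JY : jacobian_torus Y) (f : X -> Y) : set JX :=
  connected_component [set x | Nm JX JY f x = 0] 0.

End Jacobians.
Arguments Nm {R X Y} JX JY f.
Arguments Prym {R X Y} JX JY f.

Section GroupActions.
Context {R : realType} {gT : finGroupType}.
Implicit Types X Y : curve R.

(* G acts as a subgroup of Aut(X) *)
Definition curve_action X (act : gT -> X -> X) : Prop :=
  [/\ forall x, act 1%g x = x,
      forall g h x, act (g * h)%g x = act g (act h x),
      forall g, hol_map (act g) &
      forall g, (forall x, act g x = x) -> g = 1%g].

(* q identifies Y with X / M as a ringed space: the fibres are the M-orbits,
   Y has the quotient topology, and its functions are the M-invariant ones. *)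
Definition is_quotient X Y (act : gT -> X -> X) (M : {group gT}) (q : X -> Y) :
    Prop :=
  [/\ forall y, exists x, q x = y,
      forall x x', q x = q x' <-> exists2 g, g \in M & act g x = x',
      forall B : set Y, open B <-> open (q @^-1` B) &
      forall (f : Y -> C R) y,
        hol_at f y <-> forall x, q x = y -> hol_at (f \o q : X -> C R) x].

Local Notation G := [set: gT]%G.

Lemma rat_irr_inhabited : exists _ : irrType rat G, True.
Proof.
apply: asboolW; apply: (socle_exists (regular_repr rat G)) => sG.
by apply/asboolP; exists sG.
Qed.

(* the simple factors of Q[G] *)
Definition rat_irr : irrType rat G := projT1 (cid rat_irr_inhabited).

(* The unit element of the simple factor of Q[G] given by rV; Q[G] is seen as
   an algebra of matrices through its regular representation. *)
Definition simple_unit n (rV : mx_representation rat G n) : 'M[rat]_#|G| :=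
  Wedderburn_id (irr_comp rat_irr rV).

(* A = Im rho(m e), where m e = \sum_g (a g) g has integral coefficients and
   rho(g) = Nm(act g). *)
Definition is_isotypical_component X (JX : jacobian_torus X) (act : gT -> X -> X)
    n (rV : mx_representation rat G n) (A : set JX) : Prop :=
  exists (m : nat) (a : gT -> int),
    [/\ (0 < m)%N,
        m%:R *: simple_unit rV = \sum_g (a g)%:~R *: regular_repr rat G g &
        A = [set \sum_g Nm JX JX (act g) x *~ a g | x in [set: JX]]].

End GroupActions.

Section Quaternions.
Context {gT : finGroupType} (i j : gT).
Local Notation G := [set: gT]%G.

(* The presentation <i, j | i^2 = j^2 = (ij)^2> of Q8; -1 is i ^+ 2. *)
Definition is_Q8 : Prop :=
  [/\ #|gT| = 8%N, <<[set i; j]%SET>>%g = [set: gT]%SET,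
      (i ^+ 2 = j ^+ 2)%g & (i ^+ 2 = (i * j) ^+ 2)%g].

Definition is_character (rV : mx_representation rat G 1) (a b : rat) : Prop :=
  rV i = a%:M /\ rV j = b%:M.

(* Right multiplications by i and j on H_Q, in the basis 1, i, j, ij; matrices
   act on row vectors, so that this defines a representation. *)
Definition quat_i : 'M[rat]_4 := \matrix_(r, c)
  (nth [::] [:: [::  0; 1; 0;  0];
                [:: -1; 0; 0;  0];
                [::  0; 0; 0; -1];
                [::  0; 0; 1;  0]] r)`_c.

Definition quat_j : 'M[rat]_4 := \matrix_(r, c)
  (nth [::] [:: [::  0;  0; 1; 0];
                [::  0;  0; 0; 1];
                [:: -1;  0; 0; 0];
                [::  0; -1; 0; 0]] r)`_c.

Definition is_quaternion_repr (rV : mx_representation rat G 4) : Prop :=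
  rV i = quat_i /\ rV j = quat_j.

End Quaternions.

(* Main.v *)
Require Import Defs.
From HB Require Import structures.
From mathcomp Require Import all_boot all_order all_algebra all_fingroup.
From mathcomp Require Import pgroup mxrepresentation complex.
From mathcomp Require Import all_classical all_reals all_analysis.
From mathcomp Require Import ring.

Set Implicit Arguments.
Unset Strict Implicit.
Unset Printing Implicit Defensive.

Import Order.TTheory GRing.Theory Num.Theory.
Import numFieldNormedType.Exports.
Local Open Scope classical_set_scope.
Local Open Scope ring_scope.


(* Let s_g = Nm(g) on JX.  For a character chi with values +-1 the component A_R
   is the image of eps = \sum_g chi(g) s_g, and A_W is the image of 1 - s_z with
   z = -1.  If chi has kernel M, q : X -> X_M is the quotient and l is not in M,
   then eps = q^* f with f = q_*(1 - s_l), where q^* has finite kernel and the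
   image of f is P(X_M/Y) (for chi = 1 take f = q_*, with image JY); this gives
   the isogenies between the factors and the components.  The operators eps
   annihilate each other and 1 - s_z, and together with 4 (1 - s_z) they add up
   to 8, so that the product of the maps f is an isogeny.  Norms, pullbacks and
   their identities are all obtained from the universal property of the Abel-Jacobi
   map: a locally liftable holomorphic map from X to a torus factors
   through JX, uniquely on divisors of degree 0. *)

(** * Units of the simple factors of Q[G] *)

(** Everything holds only up to positive integer multiples, and three facts absorb them: complex
    tori are divisible, their n-torsion is finite, and a homomorphism whose values are all killed by
    one m > 0 vanishes. So the multiplier m of [is_isotypical_component] is harmless, and integral
    operators with e^2 = 8 e can replace idempotents. That they add up to 8 is the decomposition of
    the regular character. P(X_M/Y) is a connected component, so identifying it with an image is
    partly topological: the image must lie in the kernel, and a fixed multiple of every kernel point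
    must lie in the image. These multiples come from the two identities q^* q_* = \sum_(g in M) s_g
    and q_* q^* = |M|. The pullback q^* arises by descending x |-> \sum_(g in M) alpha(g x) to the
    quotient. Holomorphy downstairs is tested on X, so the local form of q at ramification points
    never enters. Homomorphisms of tori are turned once and for all into matrices on the universal
    covers, after which all identities are formal. *)

Section WedderburnUnits.
Context {gT : finGroupType}.
Local Notation G := [set: gT]%G.
Local Notation aG := (regular_repr rat G).

Lemma rat_pchar'_group : ([pchar rat]^'.-group G)%g.
Proof. by apply: sub_pgroup (pgroup_pi _) => p _; rewrite inE /= pchar_num. Qed.

(** Expand e as the sum of its products with the units of the simple factors. A simple factor acts
    faithfully on its irreducible module, so the product is 0 where e acts by 0, and the unit where
    e acts by 1. *)
Lemma Wedderburn_id_eq (sG : irrType rat G) n (rV : mx_representation rat G n)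
    (e : 'M[rat]_#|G|) :
  mx_irreducible rV -> (e \in group_ring rat G)%MS -> gring_op rV e = 1%:M ->
  (forall k (rS : mx_representation rat G k), mx_irreducible rS ->
     gring_op rS e != 0 -> mx_rsim rV rS) ->
  Wedderburn_id (irr_comp sG rV) = e.
Proof.
move=> irrV Re eV eS; have F'G := rat_pchar'_group.
have idRi (k : sG) : (e *m Wedderburn_id k \in Wedderburn_subring k)%MS.
  have /andP[idl _] := @Wedderburn_ideal _ _ _ sG k.
  apply: (memmx_subP idl); apply: mem_mulsmx => //; exact: Wedderburn_id_mem.
have R_ (k : sG) : (Wedderburn_id k \in group_ring rat G)%MS.
  rewrite -(Wedderburn_sum_pchar sG F'G) (sumsmx_sup k) //.
  exact: Wedderburn_id_mem.
rewrite -[RHS]mulmx1 -(Wedderburn_sum_id_pchar sG F'G) mulmx_sumr.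
rewrite (bigD1 (irr_comp sG rV)) //= big1 ?addr0 => [|k nek].
  apply: (regular_op_inj_pchar F'G irrV).
  - exact: Wedderburn_id_mem.
  - exact: idRi.
  by rewrite /= gring_opM // eV mul1mx.
have irrk : mx_irreducible (irr_repr k) by exact: socle_irr.
have compk := irr_reprK_pchar F'G k.
have inj := @regular_op_inj_pchar _ _ _ sG F'G _ _ irrk; rewrite compk in inj.
apply: inj; [exact: idRi | by rewrite inE linear0 sub0mx |].
rewrite /= gring_opM // linear0.
have [->|nz] := eqVneq (gring_op (irr_repr k) e) 0; first by rewrite mul0mx.
by case/eqP: nek; rewrite -compk; apply/esym/(irr_comp_rsim_pchar sG F'G)/eS.
Qed.

End WedderburnUnits.

Section LinearUnit.
Context {gT : finGroupType}.
Local Notation G := [set: gT]%G.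
Local Notation aG := (regular_repr rat G).

(** Here e h = chi(h) e, so a nonzero row in the image of e on an irreducible S spans a stable line.
    Hence S is this line, with character chi. *)
Lemma simple_unit_linear (rV : mx_representation rat G 1) :
  simple_unit rV = #|gT|%:R^-1 *: \sum_g rV g^-1%g 0 0 *: aG g.
Proof.
pose chi g := rV g 0 0.
have chiM g h : chi (g * h)%g = chi g * chi h.
  by rewrite /chi repr_mxM ?inE // mxE big_ord1.
have chi1 : chi 1%g = 1 by rewrite /chi repr_mx1 mxE.
have rVE g : rV g = (chi g)%:M by rewrite [LHS]mx11_scalar.
have nz : #|gT|%:R != 0 :> rat by rewrite pnatr_eq0 -lt0n -cardsT (cardG_gt0 G).
set e := RHS.
have opE k (rS : mx_representation rat G k) :
    gring_op rS e = #|gT|%:R^-1 *: \sum_g chi g^-1%g *: rS g.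
  rewrite /e !linearZ /= linear_sum; congr (_ *: _); apply: eq_bigr => g _.
  by rewrite !linearZ /= gring_opG ?inE.
apply: Wedderburn_id_eq.
- exact/mx_abs_irrW/linear_mx_abs_irr.
- apply/envelop_mxP; exists (fun g => #|gT|%:R^-1 * rV g^-1%g 0 0).
  rewrite /e scaler_sumr; apply: eq_big => g; first by rewrite inE.
  by rewrite scalerA.
- rewrite opE; under eq_bigr => g _ do
    rewrite rVE scale_scalar_mx -chiM mulVg chi1.
  rewrite sumr_const -scaler_nat scalerA.
  by rewrite mulVf ?scale1r.
move=> k rS irrS nzM; set M := gring_op rS e in nzM.
have MJ h : M *m rS h = chi h *: M.
  rewrite /M opE -scalemxAl mulmx_suml scalerA mulrC -scalerA; congr (_ *: _).
  rewrite (reindex_inj (mulIg h^-1)%g) /= scaler_sumr; apply: eq_bigr => g _.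
  rewrite -scalemxAl -repr_mxM ?inE // mulgKV invMg invgK chiM scalerA.
  by [].
have [v vM nzv] : exists2 v : 'rV_k, (v <= M)%MS & v != 0 by apply/rowV0Pn.
have vJ h : v *m rS h = chi h *: v.
  by have /submxP[w ->] := vM; rewrite -mulmxA MJ -scalemxAr.
have [k_gt0 irr'] := (mx_irrP _).1 irrS.
have vfull : row_full v.
  rewrite /row_full -(genmxE v); apply: irr'; last by rewrite -mxrank_eq0 genmxE mxrank_eq0.
  rewrite (eqmx_module _ (genmxE _)).
  by apply/mxmoduleP => h _; rewrite vJ scalemx_sub.
have k1 : k = 1%N.
  by apply/eqP; rewrite -(eqP vfull) rank_rV nzv.
exists v; first by rewrite k1.
  by rewrite /row_free rank_rV nzv.
by move=> h _; rewrite vJ rVE mul_scalar_mx.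
Qed.

End LinearUnit.

(** * The quaternion group *)

Section Q8Group.
Context {gT : finGroupType} (i j : gT) (Q8 : is_Q8 i j).
Local Open Scope group_scope.
Local Notation z := (i ^+ 2).

Lemma Q8_gen (P : {group gT}) : i \in P -> j \in P -> forall g, g \in P.
Proof.
move=> Pi Pj g; have [_ gen _ _] := Q8.
have: g \in <<[set i; j]%SET>> by rewrite gen inE.
apply: (@fintype.subsetP _ _ (mem P) _); rewrite gen_subG.
by apply/fintype.subsetP => x; rewrite !inE => /orP[]/eqP->.
Qed.

Lemma Q8_jij : j * i * j = i.
Proof.
have [_ _ _] := Q8; rewrite !expgS !expg0 !mulg1 => h.
by apply: (@mulgI _ i); rewrite h !mulgA.
Qed.

(** Applying j i j = i twice gives z i z = i, since j^2 = z; and z commutes with i. *)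
Lemma Q8_z2 : z * z = 1.
Proof.
have [_ _ e1 _] := Q8.
have jj : j * j = z by rewrite e1 !expgS expg0 mulg1.
have zz : z * i * z = i.
  by transitivity (j * (j * i * j) * j); [rewrite -jj !mulgA | rewrite !Q8_jij].
have iz : i * z = z * i by rewrite -expgS -expgSr.
by apply: (@mulgI _ i); rewrite mulg1 mulgA iz.
Qed.

Lemma Q8_ji : j * i = z * i * j.
Proof.
apply: (@mulIg _ j); rewrite Q8_jij -[RHS]mulgA.
have [_ _ e1 _] := Q8.
have -> : j * j = z by rewrite e1 !expgS expg0 mulg1.
rewrite -mulgA; have -> : i * z = z * i by rewrite -expgS -expgSr.
by rewrite mulgA Q8_z2 mul1g.
Qed.

Lemma Q8_zj : z * j = j * z.
Proof. by have [_ _ -> _] := Q8; rewrite -expgS -expgSr. Qed.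

Lemma Q8_zC g : z * g = g * z.
Proof.
have: g \in 'C[z].
  by apply: (Q8_gen (P := 'C[z]%G)); apply/cent1P; rewrite /commute ?Q8_zj // -expgS -expgSr.
by move/cent1P.
Qed.

Lemma Q8_enum g : exists c a b : bool, g = z ^+ c * i ^+ a * j ^+ b.
Proof.
suff [a [b ->]] : exists a : nat, exists b : bool, g = i ^+ a * j ^+ b.
  (* i^a = z^(a / 2) i^(a mod 2), where the exponent of z only matters modulo 2. *)
  exists (odd a./2), (odd a), b; congr (_ * _).
  have zE n : z ^+ n = z ^+ odd n.
    rewrite -{1}[n]odd_double_half expgD -muln2 mulnC expgM.
    have -> : z ^+ 2 = 1 by rewrite expgS expg1 Q8_z2.
    by rewrite expg1n mulg1.
  by rewrite -zE -expgM -expgD addnC mul2n odd_double_half.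
have: g \in <<[set i; j]%SET>> by have [_ -> _ _] := Q8; rewrite inE.
have [_ _ e1 _] := Q8.
case/gen_prodgP => n [c cP ->]; elim: n c cP => [|n IHn] c cP.
  by exists 0%N, false; rewrite big_ord0 mulg1.
rewrite big_ord_recr /=; have [|a [b ->]] := IHn (fun k => c (widen_ord (leqnSn n) k)).
  by move=> k; apply: cP.
have := cP ord_max; rewrite !inE => /orP[] /eqP ->.
  case: b; rewrite /= ?expg1 ?expg0 ?mulg1.
    (* j i = z i j = i^3 j. *)
    by exists (a + 3)%N, true; rewrite -mulgA Q8_ji expgD (expgSr i 2) expg1 !mulgA.
  by exists a.+1, false; rewrite expgSr mulg1.
case: b; rewrite /= ?expg1 ?expg0 ?mulg1; last by exists a, true.
by exists (a + 2)%N, false; rewrite expg0 mulg1 -mulgA expgD e1 !expgS expg0 mulg1.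
Qed.

End Q8Group.

Section QuaternionUnit.
Context {gT : finGroupType} (i j : gT) (Q8 : is_Q8 i j).
Local Notation G := [set: gT]%G.
Local Notation aG := (regular_repr rat G).
Local Notation z := (i ^+ 2)%g.

Definition quat_row (a b c d : rat) : 'rV[rat]_4 :=
  \row_(k < 4) [:: a; b; c; d]`_k.

Lemma quat_rowP (v : 'rV[rat]_4) : exists a b c d, v = quat_row a b c d.
Proof.
exists (v 0 ord0), (v 0 (inord 1)), (v 0 (inord 2)), (v 0 (inord 3)).
by apply/rowP => -[[|[|[|[|?]]]] ?] //; rewrite mxE /=; congr (v _ _); apply: val_inj;
   rewrite /= ?inordK.
Qed.

Lemma quat_row_i a b c d :
  quat_row a b c d *m quat_i = quat_row (- b) a d (- c).
Proof.
by apply/rowP => -[[|[|[|[|?]]]] ?] //; rewrite !mxE !big_ord_recl big_ord0 !mxE /=; ring.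
Qed.

Lemma quat_row_j a b c d :
  quat_row a b c d *m quat_j = quat_row (- c) (- d) a b.
Proof.
by apply/rowP => -[[|[|[|[|?]]]] ?] //; rewrite !mxE !big_ord_recl big_ord0 !mxE /=; ring.
Qed.

Variable rW : mx_representation rat G 4.
Hypothesis rWE : is_quaternion_repr i j rW.

Lemma quaternion_repr_z : rW z = - 1%:M.
Proof.
apply/row_matrixP => k; rewrite !rowE expgS expg1 repr_mxM ?inE // rWE.1 mulmxA.
have [a [b [c [d ->]]]] := quat_rowP (delta_mx 0 k).
rewrite !quat_row_i mulmxN mulmx1.
by apply/rowP => -[[|[|[|[|?]]]] ?] //; rewrite !mxE.
Qed.

(** W is a division algebra: a nonzero u in U, multiplied on the right by its conjugate, gives its
    norm N, a nonzero rational number. So U contains 1, and then everything. *)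
Lemma quaternion_repr_irr : mx_irreducible rW.
Proof.
apply/mx_irrP; split => // U modU nzU.
pose u := nz_row U; have nzu : u != 0 by rewrite nz_row_eq0.
have uU : (u <= U)%MS by apply: nz_row_sub.
have UJ (v : 'rV_4) g : (v <= U)%MS -> (v *m rW g <= U)%MS.
  by move=> vU; apply: mxmodule_trans => //; rewrite inE.
have [rWi rWj] := rWE.
have [a [b [c [d uE]]]] := quat_rowP u.
pose N := a ^+ 2 + b ^+ 2 + c ^+ 2 + d ^+ 2.
pose e := quat_row 1 0 0 0.
have eN : N *: e = a *: u - b *: (u *m rW i) - c *: (u *m rW j)
            - d *: (u *m rW (i * j)%g).
  rewrite repr_mxM ?inE // rWi rWj mulmxA uE !(quat_row_i, quat_row_j).
  by apply/rowP => -[[|[|[|[|?]]]] ?] //; rewrite !mxE /= /N; ring.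
have nzN : N != 0.
  apply: contra nzu; rewrite uE /N !paddr_eq0 ?addr_ge0 ?sqr_ge0 // !sqrf_eq0.
  move=> /andP[/andP[/andP[/eqP-> /eqP->] /eqP->] /eqP->].
  by apply/eqP/rowP => -[[|[|[|[|?]]]] ?] //; rewrite !mxE.
have eU : (e <= U)%MS.
  rewrite -(scalerK nzN e) eN scalemx_sub //.
  by rewrite !addmx_sub ?eqmx_opp ?scalemx_sub ?UJ.
rewrite -sub1mx; apply/rV_subP => v _.
have [a' [b' [c' [d' ->]]]] := quat_rowP v.
have -> : quat_row a' b' c' d' = a' *: e + b' *: (e *m rW i) + c' *: (e *m rW j)
            + d' *: (e *m rW (i * j)%g).
  rewrite repr_mxM ?inE // rWi rWj mulmxA !(quat_row_i, quat_row_j).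
  by apply/rowP => -[[|[|[|[|?]]]] ?] //; rewrite !mxE /=; ring.
by rewrite !addmx_sub ?scalemx_sub ?UJ.
Qed.

(* If (1 - z) / 2 does not kill the irreducible S, then z = -1 on S, and
   1, i, j, ij |-> v, vi, vj, vij is an isomorphism from W to S for any v != 0. *)
Lemma simple_unit_quaternion : simple_unit rW = 2^-1 *: (aG 1%g - aG z).
Proof.
set e := RHS.
have opE k (rS : mx_representation rat G k) :
    gring_op rS e = 2^-1 *: (1%:M - rS z).
  by rewrite /e linearZ /= linearB /= !gring_opG ?inE // repr_mx1.
apply: Wedderburn_id_eq quaternion_repr_irr _ _ _.
- by rewrite /e linearZ linearB scalemx_sub // addmx_sub ?eqmx_opp ?envelop_mx_id ?inE.
- rewrite opE quaternion_repr_z opprK -mulr2n -scaler_nat scalerA.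
  by rewrite mulVf ?scale1r.
move=> k rS irrS; rewrite opE scaler_eq0 invr_eq0 negb_or /= => nzM.
have rSz2 : rS z *m rS z = 1%:M by rewrite -repr_mxM ?inE // (Q8_z2 Q8) repr_mx1.
have rSz : rS z = - 1%:M.
  (* 1 - z is central, hence invertible on S by Schur's lemma, and its product with 1 + z is 0. *)
  have /(mx_Schur irrS) : centgmx rS (1%:M - rS z).
    apply/centgmxP => g _; rewrite mulmxBl mulmxBr mulmx1 mul1mx.
    by rewrite -!repr_mxM ?inE // (Q8_zC Q8).
  move=> /(_ nzM) Mu; apply/eqP; rewrite -addr_eq0.
  rewrite -[X in X == 0](mulKmx Mu) mulmxDr mulmx1 mulmxBl mul1mx rSz2.
  by rewrite addrA subrK subrr mulmx0.
have [k_gt0 irrS'] := (mx_irrP _).1 irrS.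
have [v nzv] : exists v : 'rV[rat]_k, v != 0.
  by exists (nz_row 1%:M); rewrite nz_row_eq0 -mxrank_eq0 mxrank1 -lt0n.
pose f : 'M[rat]_(4, k) := \matrix_(r < 4)
  [:: v; v *m rS i; v *m rS j; v *m rS i *m rS j]`_r.
have fE a b c d : quat_row a b c d *m f =
   a *: v + b *: (v *m rS i) + c *: (v *m rS j) + d *: (v *m rS i *m rS j).
  by rewrite mulmx_sum_row !big_ord_recl big_ord0 !rowK !mxE /= addr0 !addrA.
have [rWi rWj] := rWE.
have zE : rS i *m rS i = - 1%:M by rewrite -repr_mxM ?inE // -rSz expgS expg1.
have zE' : rS j *m rS j = - 1%:M.
  by rewrite -repr_mxM ?inE // -rSz; have [_ _ -> _] := Q8; rewrite expgS expg1.
have jiE : rS j *m rS i = - (rS i *m rS j).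
  by rewrite -!repr_mxM ?inE // (Q8_ji Q8) -mulgA [LHS]repr_mxM ?inE // rSz mulNmx mul1mx.
have rel_i : rW i *m f = f *m rS i.
  apply/row_matrixP => r; rewrite !rowE !mulmxA.
  have [a [b [c [d ->]]]] := quat_rowP (delta_mx 0 r).
  rewrite rWi quat_row_i !fE !mulmxDl -!scalemxAl.
  have h (w : 'rV_k) : w *m rS i *m rS i = - w by rewrite -mulmxA zE mulmxN mulmx1.
  have h' (w : 'rV_k) : w *m rS j *m rS i = - (w *m rS i *m rS j).
    by rewrite -!mulmxA jiE mulmxN.
  rewrite !h' !h mulNmx opprK.
  move: (v *m rS i *m rS j) => w3; move: (v *m rS i) (v *m rS j) => w1 w2.
  by apply/rowP => t; rewrite !mxE; ring.
have rel_j : rW j *m f = f *m rS j.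
  apply/row_matrixP => r; rewrite !rowE !mulmxA.
  have [a [b [c [d ->]]]] := quat_rowP (delta_mx 0 r).
  rewrite rWj quat_row_j !fE !mulmxDl -!scalemxAl.
  have h (w : 'rV_k) : w *m rS j *m rS j = - w by rewrite -mulmxA zE' mulmxN mulmx1.
  rewrite !h.
  move: (v *m rS i *m rS j) => w3; move: (v *m rS i) (v *m rS j) => w1 w2.
  by apply/rowP => t; rewrite !mxE; ring.
have relM g h : rW g *m f = f *m rS g -> rW h *m f = f *m rS h ->
    rW (g * h)%g *m f = f *m rS (g * h)%g.
  by move=> eg eh; rewrite !repr_mxM ?inE // -mulmxA eh !mulmxA eg.
have rel1 : rW 1%g *m f = f *m rS 1%g by rewrite !repr_mx1 mulmx1 mul1mx.
have rel_z : rW z *m f = f *m rS z.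
  by rewrite rSz quaternion_repr_z mulmxN mulNmx mulmx1 mul1mx.
have rel g : rW g *m f = f *m rS g.
  have relX (b : bool) h : rW h *m f = f *m rS h ->
      rW (h ^+ b)%g *m f = f *m rS (h ^+ b)%g by case: b.
  have [c [a [b ->]]] := Q8_enum Q8 g.
  exact: relM (relM _ _ (relX c _ rel_z) (relX a _ rel_i)) (relX b _ rel_j).
have nzf : f != 0.
  apply: contraNneq nzv => f0; have := fE 1 0 0 0.
  by rewrite f0 mulmx0 !scale0r !addr0 scale1r => <-.
have fk : row_full f.
  rewrite /row_full -(genmxE f); apply: irrS'; last by rewrite -mxrank_eq0 genmxE mxrank_eq0.
  rewrite (eqmx_module _ (genmxE _)).
  by apply/mxmoduleP => h _; rewrite -rel submxMl.
(* The kernel of f is a proper stable subspace of the irreducible W. *)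
have ff : row_free f.
  rewrite -kermx_eq0; apply: contraNT nzf => nzK.
  have [_ /(_ (kermx f))] := (mx_irrP _).1 quaternion_repr_irr.
  move=> /(_ _ nzK) Kfull; rewrite -[f]mul1mx; apply/eqP/sub_kermxP.
  rewrite sub1mx Kfull //; apply/mxmoduleP => h _; apply/sub_kermxP.
  by rewrite -mulmxA rel mulmxA mulmx_ker mul0mx.
exists f => //.
by rewrite -(eqP fk) (eqP ff).
Qed.

End QuaternionUnit.

Section Coefficients.
Context {gT : finGroupType}.
Local Notation G := [set: gT]%G.
Local Notation aG := (regular_repr rat G).

Lemma regular_repr_free (a b : gT -> rat) :
  \sum_g a g *: aG g = \sum_g b g *: aG g -> a =1 b.
Proof.
move=> ab x; have /(congr1 (gring_proj x)) := ab.
have projE (c : gT -> rat) : gring_proj x (\sum_g c g *: aG g) = (c x)%:M.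
  rewrite linear_sum (bigD1 x) //= linearZ /= gring_projE ?inE // eqxx scalemx1.
  rewrite big1 ?addr0 // => g gx; rewrite linearZ /= gring_projE ?inE //.
  by rewrite eq_sym (negbTE gx) scaler0.
by rewrite !projE => /matrixP/(_ 0 0); rewrite !mxE eqxx !mulr1n.
Qed.

End Coefficients.

(** * Sign characters of Q8 and integral coefficients of the units *)

Section Q8Characters.
Context {gT : finGroupType} (i j : gT) (Q8 : is_Q8 i j).
Local Notation G := [set: gT]%G.
Local Notation aG := (regular_repr rat G).
Local Notation z := (i ^+ 2)%g.

Definition sign_char (chi : gT -> int) : Prop :=
  [/\ {morph chi : g h / (g * h)%g >-> g * h}, chi 1%g = 1 &
      forall g, chi g = 1 \/ chi g = -1].

(** Integer values are wanted because points of a torus can only be multiplied by integers. By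
    [char_ofE] the second branch is taken only at the value -1. *)
Definition char_of (rV : mx_representation rat G 1) (g : gT) : int :=
  if rV g 0 0 == 1 then 1 else -1.

Lemma sign_charV chi g : sign_char chi -> chi g^-1%g = chi g.
Proof.
move=> [chiM chi1 chiS]; have := chiM g g^-1%g; rewrite mulgV chi1.
by case: (chiS g) => ->; case: (chiS g^-1%g) => ->.
Qed.

Variables (rV : mx_representation rat G 1) (a b : int).
Hypothesis rVE : is_character i j rV a%:~R b%:~R.
Hypothesis (aS : a = 1 \/ a = -1) (bS : b = 1 \/ b = -1).
Local Notation chi := (char_of rV).

Let rVM g h : rV (g * h)%g 0 0 = rV g 0 0 * rV h 0 0.
Proof. by rewrite repr_mxM ?inE // mxE big_ord1. Qed.

Let rV1 : rV 1%g 0 0 = 1.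
Proof. by rewrite repr_mx1 mxE. Qed.

Let rVi : rV i 0 0 = a%:~R.
Proof. by rewrite rVE.1 mxE. Qed.

Let rVj : rV j 0 0 = b%:~R.
Proof. by rewrite rVE.2 mxE. Qed.

Let rVS g : rV g 0 0 = 1 \/ rV g 0 0 = -1.
Proof.
have rVX h (n : bool) : rV h 0 0 = 1 \/ rV h 0 0 = -1 ->
    rV (h ^+ n)%g 0 0 = 1 \/ rV (h ^+ n)%g 0 0 = -1.
  by case: n => //; left.
have rVP g1 g2 : rV g1 0 0 = 1 \/ rV g1 0 0 = -1 ->
    rV g2 0 0 = 1 \/ rV g2 0 0 = -1 ->
    rV (g1 * g2)%g 0 0 = 1 \/ rV (g1 * g2)%g 0 0 = -1.
  by rewrite rVM => -[]-> []->; rewrite ?mulN1r ?opprK ?mul1r; auto.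
have hi : rV i 0 0 = 1 \/ rV i 0 0 = -1 by rewrite rVi; case: aS => ->; auto.
have hj : rV j 0 0 = 1 \/ rV j 0 0 = -1 by rewrite rVj; case: bS => ->; auto.
have [c [x [y ->]]] := Q8_enum Q8 g.
have hz : rV z 0 0 = 1 \/ rV z 0 0 = -1 by rewrite expgS expg1; apply: rVP.
exact: rVP (rVP _ _ (rVX _ c hz) (rVX _ x hi)) (rVX _ y hj).
Qed.

Lemma char_ofE g : rV g 0 0 = (chi g)%:~R.
Proof. by rewrite /char_of; case: (rVS g) => ->. Qed.

Lemma char_of_sign : sign_char chi.
Proof.
split=> [g h||g].
- by apply: (@intr_inj rat); rewrite rmorphM /= -!char_ofE.
- by rewrite /char_of rV1 eqxx.
- by rewrite /char_of; case: ifP; auto.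
Qed.

Lemma char_ofi : chi i = a.
Proof. by apply: (@intr_inj rat); rewrite -char_ofE. Qed.

Lemma char_ofj : chi j = b.
Proof. by apply: (@intr_inj rat); rewrite -char_ofE. Qed.

(** Coefficients in the regular representation are unique. Denominators are cleared to stay in
    [int], and chi(g^-1) = chi(g) for values +-1. *)
Lemma char_unit_coef (m : nat) (c : gT -> int) :
  m%:R *: simple_unit rV = \sum_g (c g)%:~R *: aG g ->
  forall g, #|gT|%:R * c g = m%:R * chi g.
Proof.
rewrite simple_unit_linear scalerA scaler_sumr.
under eq_bigr do rewrite scalerA.
move=> /regular_repr_free h g; apply: (@intr_inj rat).
have nz : #|gT|%:R != 0 :> rat by rewrite pnatr_eq0 -lt0n -cardsT (cardG_gt0 G).
rewrite !rmorphM /= !rmorph_nat -h !char_ofE (sign_charV _ char_of_sign).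
by rewrite mulrA [_ * (_ / _)]mulrC divfK.
Qed.

End Q8Characters.

Section Q8Sums.
Context {gT : finGroupType} (i j : gT) (Q8 : is_Q8 i j).
Local Notation G := [set: gT]%G.
Local Notation aG := (regular_repr rat G).
Local Notation z := (i ^+ 2)%g.

Lemma quaternion_unit_coef (rW : mx_representation rat G 4) (m : nat) (c : gT -> int) :
  is_quaternion_repr i j rW ->
  m%:R *: simple_unit rW = \sum_g (c g)%:~R *: aG g ->
  forall g, 2 * c g = m%:R * ((g == 1%g)%:R - (g == z)%:R).
Proof.
move=> rWE; rewrite (simple_unit_quaternion Q8 rWE) => h g.
pose b (x : gT) : rat := m%:R * (2^-1 * ((x == 1%g)%:R - (x == z)%:R)).
have delta x : \sum_g (g == x)%:R *: aG g = aG x.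
  rewrite (bigD1 x) //= eqxx scale1r big1 ?addr0 // => y /negbTE ->.
  by rewrite scale0r.
have bE : \sum_g b g *: aG g = \sum_g (c g)%:~R *: aG g.
  rewrite -h -(delta 1%g) -(delta z) -sumrB !scaler_sumr; apply: eq_bigr => x _.
  by rewrite -scalerBl !scalerA -mulrA.
apply: (@intr_inj rat); rewrite rmorphM /= -(regular_repr_free bE g) /b.
by rewrite !rmorphM rmorphB /= !rmorph_nat mulrCA; congr (_ * _); rewrite mulrA divff ?mul1r.
Qed.

Lemma z_neq1 (rW : mx_representation rat G 4) : is_quaternion_repr i j rW -> z != 1%g.
Proof.
move=> rWE; apply/eqP => z1; have := quaternion_repr_z rWE; rewrite z1 repr_mx1.
by move=> /matrixP/(_ 0 0); rewrite !mxE.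
Qed.

(** Right translation by l exchanges <k> and its complement. With l on the right it acts first: for
    f g = s_g x the summand is s_h (x - s_l x). *)
Lemma big_sign_char (V : zmodType) (k l : gT) (chi : gT -> int) (f : gT -> V) :
  sign_char chi -> (forall g, (g \in <[k]>%g) = (chi g == 1)) -> chi l = -1 ->
  \sum_g f g *~ chi g = \sum_(h in <[k]>%g) (f h - f (h * l)%g).
Proof.
move=> [chiM chi1 chiS] kE chil.
rewrite (bigID (mem <[k]>%g)) /= big_split /=; congr (_ + _).
  by apply: eq_bigr => g; rewrite kE => /eqP ->.
rewrite (reindex_inj (mulIg l)) /=; apply: eq_big => g.
  by rewrite !kE chiM chil; case: (chiS g) => ->.
by rewrite kE; case: (chiS (g * l)%g) => ->; rewrite ?eqxx // mulrNz mulr1z.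
Qed.

Lemma sign_char_sum0 (chi : gT -> int) l :
  sign_char chi -> chi l = -1 -> \sum_g chi g = 0.
Proof.
move=> [chiM chi1 chiS] chil; have : \sum_g chi g = - \sum_g chi g.
  rewrite {1}(reindex_inj (mulIg l)) /= -sumrN; apply: eq_bigr => g _.
  by rewrite chiM chil mulrN1.
by move=> /eqP; rewrite -addr_eq0 -mulr2n mulrn_eq0 => /eqP.
Qed.

(** A sign character is 1 at z = i^2, so on z^c i^x j^y it depends only on x and y; and i, j, ij all
    have square z. *)
Lemma cycle_ker (chi : gT -> int) : sign_char chi ->
  [/\ chi i = 1 -> chi j = -1 -> forall g, (g \in <[i]>%g) = (chi g == 1),
      chi i = -1 -> chi j = 1 -> forall g, (g \in <[j]>%g) = (chi g == 1)
    & chi i = -1 -> chi j = -1 -> forall g, (g \in <[i * j]>%g) = (chi g == 1)].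
Proof.
move=> [chiM chi1 chiS].
have chiX g n : chi (g ^+ n)%g = chi g ^+ n.
  by elim: n => [|n IHn]; rewrite ?expg0 // expgS chiM IHn exprS.
have chiz : chi z = 1 by rewrite chiX; case: (chiS i) => ->.
have zk k n : (k ^+ 2 = z)%g -> (z ^+ n)%g \in <[k]>%g.
  by move=> <-; rewrite !groupX ?cycle_id.
have [_ _ e1 e2] := Q8.
have kP k : chi k = 1 -> forall g, g \in <[k]>%g -> chi g == 1.
  by move=> k1 g /cycleP[n ->]; rewrite chiX k1 expr1n.
split=> ci cj g; apply/idP/idP; try apply: kP; rewrite ?chiM ?ci ?cj //.
all: have [c [x [y ->]]] := Q8_enum Q8 g; rewrite !chiM (chiX z) chiz expr1n mul1r !chiX.
- case: y; rewrite ci cj expr1n ?expr1 // => _.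
  by rewrite mulg1 groupM ?zk // groupX ?cycle_id.
- case: x; rewrite ci cj expr1n ?mulr1 // => _.
  by rewrite mulg1 groupM ?zk // groupX ?cycle_id.
case: x; case: y; rewrite ci cj ?expr1 ?expr0 ?mulr1 ?mul1r // => _.
  by rewrite -mulgA groupM ?zk // cycle_id.
by rewrite !expg0 !mulg1 zk.
Qed.

(** This is the decomposition of the regular character: the last term on the left is 2 chi_V, where
    chi_V = 2 (delta_1 - delta_z) is the character of the two-dimensional V. *)
Lemma quaternion_sum (rW : mx_representation rat G 4) (chi_i chi_j chi_ij : gT -> int) :
  is_quaternion_repr i j rW ->
  sign_char chi_i -> sign_char chi_j -> sign_char chi_ij ->
  chi_i i = 1 -> chi_i j = -1 -> chi_j i = -1 -> chi_j j = 1 ->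
  chi_ij i = -1 -> chi_ij j = -1 ->
  forall g, 1 + chi_i g + chi_j g + chi_ij g + 4 * ((g == 1%g)%:R - (g == z)%:R)
    = 8 * (g == 1%g)%:R.
Proof.
move=> rWE si sj sij ii ij ji jj iji ijj g.
have z1 := z_neq1 rWE.
have charE chi : sign_char chi -> forall c x y : bool,
    chi (z ^+ c * i ^+ x * j ^+ y)%g = chi i ^+ x * chi j ^+ y.
  move=> [chiM chi1 chiS].
  have chiX h (n : bool) : chi (h ^+ n)%g = chi h ^+ n by case: n.
  have chiz : chi z = 1 by rewrite expgS expg1 chiM; case: (chiS i) => ->.
  by move=> c x y; rewrite !chiM (chiX z) chiz expr1n mul1r !chiX.
have neq chi x : sign_char chi -> chi x = -1 -> (x == 1%g = false) /\ (x == z = false).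
  move=> s x1; have := charE _ s true false false; have := charE _ s false false false.
  rewrite /= !expg0 !mulg1 expg1 => c1 cz.
  by split; apply/eqP => xE; move: x1; rewrite xE ?c1 ?cz.
have [c [x [y gE]]] := Q8_enum Q8 g.
have Ei := charE _ si c x y; have Ej := charE _ sj c x y; have Eij := charE _ sij c x y.
rewrite -gE ii ij in Ei; rewrite -gE ji jj in Ej; rewrite -gE iji ijj in Eij.
case: x y gE Ei Ej Eij => -[] gE /= Ei Ej Eij; rewrite Ei Ej Eij.
- by have [-> ->] := neq _ g si Ei.
- by have [-> ->] := neq _ g sj Ej.
- by have [-> ->] := neq _ g si Ei.
case: c gE => ->; rewrite /= !mulg1 ?expg1 ?expg0 eqxx ?(negbTE z1) //.
by rewrite eq_sym (negbTE z1).
Qed.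

End Q8Sums.

(** * Complex tori *)

Section ComplexAnalysis.
Context {R : realType}.
Local Notation C := (C R).
Local Open Scope complex_scope.

Definition toC (x : R) : C := x%:C.

Lemma toC0 : toC 0 = 0. Proof. by []. Qed.

Lemma toC1 : toC 1 = 1. Proof. by []. Qed.

Lemma toCD : {morph toC : x y / x + y}. Proof. exact: rmorphD. Qed.

Lemma toCB : {morph toC : x y / x - y}. Proof. exact: rmorphB. Qed.

Lemma toCM : {morph toC : x y / x * y}. Proof. exact: rmorphM. Qed.

Lemma toC_norm (x : R) : `|toC x| = toC `|x|.
Proof. by rewrite /toC [LHS]normc_def /= expr0n addr0 sqrtr_sqr. Qed.

Lemma toC_lt (x y : R) : (toC x < toC y) = (x < y).
Proof. exact: ltcR. Qed.

Lemma toC_le (x y : R) : (toC x <= toC y) = (x <= y).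
Proof. exact: lecR. Qed.

Lemma toC_ge0 (x : R) : (0 <= toC x) = (0 <= x).
Proof. exact: lecR. Qed.

(** Radii of balls are elements of C. The positive ones are real, so they can be handled as elements
    of R. *)
Lemma toC_gt0P (e : C) : 0 < e -> exists2 d : R, 0 < d & e = toC d.
Proof.
case: e => a b; rewrite ltcE /= => /andP[/eqP -> a0].
by exists a.
Qed.

Lemma toC_continuous : continuous toC.
Proof.
move=> x U /nbhs_ballP[_/toC_gt0P[d d0 ->] dU].
apply/nbhs_ballP; exists d => // y; rewrite /ball /= => xy; apply: dU.
by rewrite /ball /= -toCB toC_norm toC_lt.
Qed.

Lemma is_derive0_estimate (g : C -> C) (z : C) (e : R) : is_derive z 1 g 0 -> 0 < e ->
  \forall h \near (0 : C), `|g (h + z) - g z| <= toC e * `|h|.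
Proof.
move=> [dg g0] e0.
have : (fun h => h^-1 *: ((g \o shift z) (h *: 1) - g z)) @ 0^' --> 'D_1 g z := dg.
rewrite g0; move/cvgrPdist_le => /(_ (toC e)); rewrite toC_lt => /(_ e0).
rewrite /dnbhs near_withinE; apply: filterS => h /= hP.
have [->|h0] := eqVneq h 0; first by rewrite add0r subrr normr0 mulr0.
have := hP h0; rewrite sub0r normrN normrZ normfV /= ler_pdivrMl ?normr_gt0 //.
by rewrite [h *: 1]mulr1 mulrC.
Qed.

(** The mean value theorem concerns real functions of a real variable, whence Re g and a segment. *)
Lemma Re_cst_on_ball (g : C -> C) (z0 : C) (e : C) :
  (forall z, ball z0 e z -> is_derive z 1 g 0) ->
  forall z, ball z0 e z -> complex.Re (g z) = complex.Re (g z0).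
Proof.
move=> dg z; rewrite /ball /= => ez.
(* mean value theorem along the segment from z0 to z *)
pose d := z - z0; pose u (t : R) := complex.Re (g (toC t * d + z0)).
have de : `|d| < e by rewrite distrC.
have uder (t : R) : t \in `[0, 1]%R -> is_derive t 1 u 0.
  rewrite in_itv /= => /andP[t0 t1].
  have tb : ball z0 e (toC t * d + z0).
    rewrite /ball /= opprD addrCA subrr addr0 normrN normrM toC_norm.
    apply: le_lt_trans de; rewrite ler_piMl // -[1]/(toC 1) toC_le ger0_norm //.
  have lim0 : (fun h => h^-1 *: ((u \o shift t) (h *: 1) - u t)) @ 0^' --> (0 : R).
    apply/cvgrPdist_le => eps eps0.
    (* D = |d| + 1 bounds |d| and is never 0, even when z = z0. *)
    have d1 : 0 < `|d| + 1 by rewrite ltr_wpDl.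
    have [D D0 dD] := toC_gt0P d1.
    have /nbhs_ballP[_ /toC_gt0P[del del0 ->] est] :=
      is_derive0_estimate (dg _ tb) (divr_gt0 eps0 D0).
    rewrite /dnbhs near_withinE; apply/nbhs_ballP; exists (del / D).
      exact: divr_gt0.
    move=> h; rewrite /ball /= !sub0r !normrN => hd h0.
    rewrite normrZ normfV ler_pdivrMl ?normr_gt0 //.
    have hdd : ball 0 (toC del) (toC h * d).
      rewrite /ball /= sub0r normrN normrM toC_norm.
      apply: (@le_lt_trans _ _ (toC (`|h| * D))).
        by rewrite toCM ler_wpM2l ?toC_ge0 // -dD lerDl.
      by rewrite toC_lt -ltr_pdivlMr.
    have := est _ hdd; rewrite addrA -mulrDl -toCD => est1.
    rewrite /u /= [h *: 1]mulr1 -raddfB /=.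
    rewrite -toC_le; apply: le_trans (normc_ge_Re _) _; apply: le_trans est1 _.
    have -> : toC (`|h| * eps) = toC (eps / D) * (toC `|h| * toC D).
      by rewrite -!toCM; congr toC; field; rewrite gt_eqF.
    rewrite normrM toC_norm ler_wpM2l //.
      by rewrite toC_ge0 divr_ge0 ?ltW.
    by rewrite ler_wpM2l ?toC_ge0 // -dD lerDl.
  have du : derivable u t 1 by apply: cvgP lim0.
  by split => //; apply: cvg_lim lim0.
have cont : {within `[0, 1], continuous u}.
  apply: continuous_in_subspaceT => x; rewrite inE => x01.
  apply: differentiable_continuous; apply/derivable1_diffP.
  by case: (uder x x01).
have der (x : R) : x \in `]0, 1[%R -> is_derive x 1 u 0.
  by move=> x01; apply: uder; apply: subset_itv_oo_cc x01.
have [c _] := MVT_segment ler01 der cont.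
rewrite mul0r => /eqP; rewrite subr_eq0 /u toC1 toC0 mul1r mul0r add0r => /eqP.
by rewrite /d subrK.
Qed.

(** Im g is minus the real part of i g, whose derivative is 0 as well. *)
Lemma cst_on_ball (g : C -> C) (z0 : C) (e : C) :
  (forall z, ball z0 e z -> is_derive z 1 g 0) ->
  forall z, ball z0 e z -> g z = g z0.
Proof.
move=> dg z ez.
have dg' x : ball z0 e x -> is_derive x 1 ('i%C *: g) 0.
  by move=> /dg h; apply: is_derive_eq; rewrite scaler0.
have r := Re_cst_on_ball dg ez.
have imE x : complex.Re (('i%C *: g) x) = - complex.Im (g x).
  by rewrite -ReiNIm mulrC.
have := Re_cst_on_ball dg' ez; rewrite !imE => /oppr_inj.
by move: r; case: (g z) (g z0) => [a b] [a' b'] /= -> ->.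
Qed.

End ComplexAnalysis.

Section RowMaps.
Context {K : numFieldType}.

Lemma differentiable_rV (E : normedModType K) n (f : E -> 'rV[K]_n) x :
  (forall k, differentiable (fun y => f y 0 k : K) x) -> differentiable f x.
Proof.
move=> df.
have -> : f = \sum_(k < n) (fun y => (f y 0 k : K) *: (delta_mx 0 k : 'rV[K]_n)).
  by apply/funext => y; rewrite fct_sumE -row_sum_delta.
by apply: differentiable_sum => k; apply: differentiableZl.
Qed.

Lemma differentiable_mulmxr n m (L : 'M[K]_(n, m)) (v : 'rV[K]_n) :
  differentiable (fun w : 'rV[K]_n => w *m L) v.
Proof.
have -> : (fun w : 'rV[K]_n => w *m L) =
    \sum_(k < n) (fun w : 'rV[K]_n => (w 0 k : K) *: row k L).
  by apply/funext => w; rewrite fct_sumE mulmx_sum_row.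
by apply: differentiable_sum => k; apply: differentiableZl; apply: differentiable_coord.
Qed.

Lemma mulmxr_continuous n m (L : 'M[K]_(n, m)) :
  continuous (fun w : 'rV[K]_n => w *m L).
Proof. by move=> v; apply: differentiable_continuous; apply: differentiable_mulmxr. Qed.

End RowMaps.

Section RowVectors.
Context {R : realType}.
Local Notation C := (C R).

Lemma cvg_halvings : (2 ^- k : C) @[k --> \oo] --> (0 : C).
Proof.
have -> : (fun k => 2 ^- k : C) = toC \o (fun k => 2^-1 ^+ k).
  apply/funext => k /=; rewrite /toC rmorphXn /= fmorphV /= exprVn.
  by congr (_ ^-1); rewrite rmorph_nat.
apply: cvg_comp; last exact: (@toC_continuous R 0).
by apply: cvg_expr; rewrite ger0_norm ?invr_ge0 // invf_lt1 // ltr1n.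
Qed.

Lemma near_halvings n (P : set 'rV[C]_n) (v : 'rV[C]_n) :
  nbhs (0 : 'rV[C]_n) P -> exists k : nat, P ((2 ^- k : C) *: v).
Proof.
move=> P0; have h : ((2 ^- k : C) *: v) @[k --> \oo] --> (0 : 'rV[C]_n).
  by rewrite -(scale0r v); apply: cvgZr_tmp; apply: cvg_halvings.
have [k _ kP] := h _ P0; exists k; exact: (kP k (leqnn k)).
Qed.

Lemma scale_halving n (k : nat) (w : 'rV[C]_n) :
  (2 ^- k : C) *: w = (2 ^- k.+1 : C) *: w + (2 ^- k.+1 : C) *: w.
Proof.
rewrite -scalerDl; congr (_ *: _); rewrite exprS invfM -mulrDl.
rewrite [X in X * _](_ : _ = 1) ?mul1r //.
by rewrite -mulr2n -[_ *+ 2]mulr_natr mulVf ?pnatr_eq0.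
Qed.

Lemma scale_doubling n (k : nat) (w : 'rV[C]_n) :
  (2 ^+ k : C) *: (w + w) = (2 ^+ k.+1 : C) *: w.
Proof. by rewrite scalerDr -scalerDl exprS mulr_natl mulr2n. Qed.

(* g w = 2^k g(w / 2^k) for all k, and the right-hand side tends to dg_0(w). *)
Lemma doubling_linear n m (g : 'rV[C]_n -> 'rV[C]_m) :
  differentiable g 0 -> g 0 = 0 ->
  (\forall w \near (0 : 'rV[C]_n), g (w + w) = g w + g w) ->
  \forall w \near (0 : 'rV[C]_n), g w = 'd g 0 w.
Proof.
move=> gd g00 /nbhs_ballP[_ /toC_gt0P[e e0 ->] eP].
apply/nbhs_ballP; exists (toC e); first by rewrite /= toC_lt.
move=> w ew.
have e2 k : ball (0 : 'rV[C]_n) (toC e) ((2 ^- k : C) *: w).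
  move: ew; rewrite -ball_normE /= !sub0r !normrN normrZ; apply: le_lt_trans.
  rewrite ler_piMl // ger0_norm ?invr_ge0 ?exprn_ge0 // invf_le1 ?exprn_gt0 //.
  by rewrite exprn_ege1 // ler1n.
have gk k : g w = (2 ^+ k : C) *: g ((2 ^- k : C) *: w).
  elim: k => [|k ->]; first by rewrite expr0 invr1 !scale1r.
  by rewrite (scale_halving k w) (eP _ (e2 k.+1)) scale_doubling.
have lim1 : (fun h => h^-1 *: ((g \o shift 0) (h *: w) - g 0)) @ 0^' --> ('d g 0 w).
  by rewrite -deriveE //; exact: (@diff_derivable _ _ _ _ _ w gd).
have half0 : (2 ^- k : C) @[k --> \oo] --> (0 : C)^'.
  move=> A; rewrite /dnbhs /= => A0.
  have [N _ NP] := @cvg_halvings _ A0; by exists N => // k Nk; apply: NP => //=.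
have := cvg_comp _ _ half0 lim1.
have -> : (fun h => h^-1 *: ((g \o shift 0) (h *: w) - g 0)) \o (fun k => 2 ^- k) = cst (g w).
  by apply/funext => k /=; rewrite g00 subr0 addr0 invrK -gk.
move=> lim2; apply: (cvg_unique (@norm_hausdorff _ _) _ lim2); exact: cvg_cst.
Qed.

End RowVectors.

Section TorusBasics.
Context {R : realType}.
Implicit Types S T U : torus R.
Local Notation C := (C R).

Lemma texp0 T : texp (0 : 'rV_(tdim T)) = 0.
Proof. by apply: (@addrI _ (texp 0)); rewrite -texpD !addr0. Qed.

Lemma texpN T (v : 'rV_(tdim T)) : texp (- v) = - texp v.
Proof. by apply/eqP; rewrite -addr_eq0 -texpD addNr texp0. Qed.

Lemma texpB T (u v : 'rV_(tdim T)) : texp (u - v) = texp u - texp v.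
Proof. by rewrite texpD texpN. Qed.

Lemma texpMn T (v : 'rV_(tdim T)) n : texp (v *+ n) = texp v *+ n.
Proof. by elim: n => [|n IHn]; rewrite ?texp0 // !mulrS texpD IHn. Qed.

Lemma torus_divisible T (x : T) n : (0 < n)%N -> exists y, y *+ n = x.
Proof.
move=> n0; have [v <-] := texp_surj x; exists (texp ((n%:R^-1 : C) *: v)).
by rewrite -texpMn -scaler_nat scalerA divff ?scale1r // pnatr_eq0 -lt0n.
Qed.

(** The difference f - a is a lattice vector tending to 0, and the lattice is discrete. This is how
    two lifts of one map are compared. *)
Lemma texp_cst_near T (X : Type) (F : set_system X) (f : X -> 'rV_(tdim T)) a :
  Filter F -> f @ F --> a -> (\forall y \near F, texp (f y) = texp a) ->
  \forall y \near F, f y = a.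
Proof.
move=> FF fa fc.
have fa0 : (f y - a) @[y --> F] --> (0 : 'rV_(tdim T)).
  by rewrite -(subrr a); apply: cvgB => //; apply: cvg_cst.
have h0 : \forall y \near F, texp (f y - a) = 0 -> f y - a = 0.
  exact: (fa0 _ (@texp_discrete R T)).
apply: filterS2 fc h0 => y fy; rewrite texpB fy subrr => /(_ erefl) /eqP.
by rewrite subr_eq0 => /eqP.
Qed.

(** L is the analytic representation of h, acting on rows from the right. That h is a map on points
    contains the compatibility of L with the lattices. *)
Definition lin_hom S T (h : S -> T) : Prop :=
  exists L : 'M[C]_(tdim S, tdim T), forall v, h (texp v) = texp (v *m L).

Lemma lin_homD S T (h : S -> T) : lin_hom h -> {morph h : x y / x + y}.
Proof.
move=> [L hL] x y; have [u <-] := texp_surj x; have [v <-] := texp_surj y.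
by rewrite -texpD !hL mulmxDl texpD.
Qed.

Lemma lin_hom0 S T (h : S -> T) : lin_hom h -> h 0 = 0.
Proof. by move=> hh; apply: (@addrI _ (h 0)); rewrite -(lin_homD hh) !addr0. Qed.

Lemma lin_homN S T (h : S -> T) : lin_hom h -> {morph h : x / - x}.
Proof.
by move=> hh x; apply/eqP; rewrite -addr_eq0 -(lin_homD hh) addNr (lin_hom0 hh).
Qed.

Lemma lin_homB S T (h : S -> T) : lin_hom h -> {morph h : x y / x - y}.
Proof. by move=> hh x y; rewrite (lin_homD hh) (lin_homN hh). Qed.

Lemma lin_homMn S T (h : S -> T) : lin_hom h -> forall n, {morph h : x / x *+ n}.
Proof.
move=> hh n x; elim: n => [|n IHn]; first by rewrite !mulr0n (lin_hom0 hh).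
by rewrite !mulrS (lin_homD hh) IHn.
Qed.

Lemma lin_homMz S T (h : S -> T) : lin_hom h -> forall n, {morph h : x / x *~ n}.
Proof.
move=> hh [] n x; first exact: lin_homMn.
by rewrite NegzE !mulrNz (lin_homN hh); congr (- _); exact: lin_homMn.
Qed.

Lemma lin_hom_big S T (h : S -> T) (I : Type) (r : seq I) (P : pred I) (F : I -> S) :
  lin_hom h -> h (\sum_(k <- r | P k) F k) = \sum_(k <- r | P k) h (F k).
Proof. by move=> hh; exact: (big_morph h (lin_homD hh) (lin_hom0 hh)). Qed.

Lemma lin_hom_comp S T U (h : S -> T) (k : T -> U) :
  lin_hom h -> lin_hom k -> lin_hom (k \o h).
Proof.
by move=> [L hL] [M kM]; exists (L *m M) => v; rewrite /= hL kM mulmxA.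
Qed.

Lemma lin_hom_id T : lin_hom (@idfun T).
Proof. by exists 1%:M => v; rewrite mulmx1. Qed.

Lemma lin_hom_add S T (h k : S -> T) :
  lin_hom h -> lin_hom k -> lin_hom (fun x => h x + k x).
Proof.
by move=> [L hL] [M kM]; exists (L + M) => v; rewrite hL kM mulmxDr texpD.
Qed.

Lemma lin_hom_opp S T (h : S -> T) : lin_hom h -> lin_hom (fun x => - h x).
Proof. by move=> [L hL]; exists (- L) => v; rewrite hL mulmxN texpN. Qed.

Lemma lin_hom_sub S T (h k : S -> T) :
  lin_hom h -> lin_hom k -> lin_hom (fun x => h x - k x).
Proof. by move=> hh kk; apply: lin_hom_add => //; apply: lin_hom_opp. Qed.

Lemma lin_hom_muln S T (h : S -> T) n : lin_hom h -> lin_hom (fun x => h x *+ n).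
Proof.
by move=> [L hL]; exists (L *+ n) => v; rewrite hL -texpMn [in RHS](raddfMn (mulmx v)).
Qed.

Lemma lin_hom_sum S T (I : finType) (P : pred I) (h : I -> S -> T) :
  (forall k, lin_hom (h k)) -> lin_hom (fun x => \sum_(k | P k) h k x).
Proof.
move=> hh; pose L k := projT1 (cid (hh k)).
have hL k v : h k (texp v) = texp (v *m L k) by exact: (projT2 (cid (hh k))).
exists (\sum_(k | P k) L k) => v; rewrite mulmx_sumr.
by rewrite (big_morph _ (@texpD R T) (@texp0 T)); apply: eq_bigr => k _.
Qed.

Lemma lin_hom_pair S T U (h : S -> T) (k : S -> U) :
  lin_hom h -> lin_hom k -> @lin_hom S (prod_torus T U) (fun x => (h x, k x)).
Proof.
move=> [L hL] [M kM]; exists (row_mx L M) => v.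
by rewrite /= /prod_texp mul_mx_row row_mxKl row_mxKr hL kM.
Qed.

Lemma lin_hom_continuous S T (h : S -> T) : lin_hom h -> continuous h.
Proof.
move=> [L hL]; apply/continuousP => A oA.
have -> : h @^-1` A = texp @` ((fun v => texp (v *m L)) @^-1` A).
  apply/seteqP; split => [x /= Ax|_ [v /= Av <-] /=]; last by rewrite hL.
  by have [v vx] := texp_surj x; exists v; rewrite //= -hL vx.
apply: texp_open; apply: open_comp => // v _.
exact: cvg_comp _ _ (@mulmxr_continuous _ _ _ L v) (@texp_continuous R T _).
Qed.

Lemma lin_hom_torus_hom S T (A : set S) (h : S -> T) : lin_hom h -> torus_hom A h.
Proof.
move=> hh; split=> [x y _ _|v _]; first exact: lin_homD.
have [L hL] := hh; exists (fun w => w *m L); last exact: (@filterE _ (nbhs v)).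
by apply: (@filterE _ (nbhs v)) => w; apply: differentiable_mulmxr.
Qed.

(** A local lift g at 0 with g 0 = 0 satisfies g (2 w) = 2 g w up to a lattice vector tending to 0,
    hence exactly for small w, and is linear there by [doubling_linear]. Any v becomes small after
    enough halvings, and additivity of h carries the formula back to v. *)
Lemma torus_hom_lin S T (h : S -> T) : torus_hom setT h -> lin_hom h.
Proof.
move=> [hD hloc].
have hM : {morph h : x y / x + y} by move=> x y; apply: hD; rewrite inE.
have h0 : h 0 = 0 by apply: (@addrI _ (h 0)); rewrite -hM !addr0.
have hMn x n : h (x *+ n) = h x *+ n.
  by elim: n => [|n IHn]; rewrite ?h0 // !mulrS hM IHn.
have [g0 g0d g0E] := hloc 0 I.
pose g w := g0 w - g0 0.
have gd : differentiable g 0.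
  by apply: differentiableB; [exact: nbhs_singleton g0d | exact: differentiable_cst].
have gE : \forall w \near (0 : 'rV_(tdim S)), h (texp w) = texp (g w).
  have g00 : texp (g0 0) = 0.
    by have := nbhs_singleton g0E; rewrite texp0 h0 => /(_ I) <-.
  by apply: filterS g0E => w /(_ I) ->; rewrite /g texpB g00 subr0.
have g00 : g 0 = 0 by rewrite /g subrr.
have gc : g w @[w --> (0 : 'rV[C]_(tdim S))] --> (0 : 'rV_(tdim T)).
  by rewrite -[X in _ --> X]g00; exact: differentiable_continuous gd.
have dbl : \forall w \near (0 : 'rV_(tdim S)), g (w + w) = g w + g w.
  have w2 : (w + w) @[w --> (0 : 'rV[C]_(tdim S))] --> (0 : 'rV[C]_(tdim S)).
    by rewrite -[X in _ --> X](addr0 0); exact: (cvgD (f:=id) (g:=id) cvg_id cvg_id).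
  have c2 : (g (w + w) - (g w + g w)) @[w --> (0 : 'rV[C]_(tdim S))] --> (0 : 'rV_(tdim T)).
    rewrite -[X in _ --> X](subrr 0) -[X in _ - X](addr0 0).
    exact: cvgB (cvg_comp _ _ w2 gc) (cvgD gc gc).
  have H := texp_cst_near (nbhs_filter (0 : 'rV[C]_(tdim S))) c2.
  have gE2 : \forall w \near (0 : 'rV_(tdim S)), h (texp (w + w)) = texp (g (w + w)).
    exact: (w2 _ gE).
  have H2 : \forall w \near (0 : 'rV_(tdim S)),
      texp (g (w + w) - (g w + g w)) = texp (0 : 'rV_(tdim T)).
    apply: filterS2 gE gE2 => w e1 e2.
    by rewrite texpB -e2 texpD hM e1 texpD texp0; exact: subrr.
  by apply: filterS (H H2) => w /eqP; rewrite subr_eq0 => /eqP.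
have near0 := filterI gE (doubling_linear gd g00 dbl).
exists (lin1_mx ('d g 0)) => v; rewrite mul_rV_lin1.
have [k [kE kd]] := near_halvings v (near0 (nbhs_filter _)).
have vE : v = ((2 ^- k : C) *: v) *+ (2 ^ k).
  by rewrite -scaler_nat scalerA natrX divff ?scale1r // expf_neq0 // pnatr_eq0.
by rewrite vE texpMn hMn kE kd -texpMn linearMn.
Qed.

Lemma torus_shift_continuous T (t : T) : continuous (fun x => x - t).
Proof.
move=> x; apply: (@continuous2_cvg _ _ _ _ _ _ _ _ (fun a b : T => a - b)).
- exact: (@sub_continuous T (x, t)).
- exact: cvg_id.
- exact: cvg_cst.
Qed.

(** For lifts a and b of distinct points, a - b is outside the discrete lattice, hence at positive
    distance from it. *)
Lemma torus_hausdorff T : hausdorff_space T.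
Proof.
have [_ /toC_gt0P[d d0 ->] dP] := (nbhs_ballP _ _).1 (@texp_discrete R T).
move=> p q; have [a <-] := texp_surj p; have [b <-] := texp_surj q => pq.
apply/eqP; rewrite -subr_eq0 -texpB; apply/negPn/negP => /eqP ab.
(* If a lattice vector l lies within d / 2 of a - b, it is the only one there, and e is half its
   distance to a - b. Otherwise e = d / 4. *)
have [e [e0 eP]] : exists e : R, 0 < e /\
    forall w : 'rV[C]_(tdim T), `|w - (a - b)| < toC (e + e) -> texp w <> 0.
  have [[l [lab l0]]|nol] := pselect (exists l : 'rV[C]_(tdim T),
      `|l - (a - b)| < toC (d / 2) /\ texp l = 0).
    have n0 : 0 < `|l - (a - b)|.
      by rewrite normr_gt0 subr_eq0; apply/eqP => lE; apply: ab; rewrite -lE.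
    have [f f0 fE] := toC_gt0P n0; rewrite fE toC_lt in lab.
    exists (f / 2); split; first by rewrite divr_gt0.
    move=> w; rewrite -splitr => wab w0.
    have : w - l = 0.
      apply: dP; last by rewrite texpB w0 l0 subrr.
      have tri : `|w - l| <= `|w - (a - b)| + `|l - (a - b)|.
        rewrite -[X in `|X| <= _](_ : w - (a - b) - (l - (a - b)) = _) ?ler_normB //.
        by apply/rowP => k; rewrite !mxE; ring.
      rewrite -ball_normE /= sub0r normrN; apply: (le_lt_trans tri); rewrite fE.
      have -> : toC d = toC (d / 2) + toC (d / 2) by rewrite -toCD -splitr.
      by rewrite ltrD ?toC_lt //; apply: lt_trans wab _; rewrite toC_lt.
    move/eqP; rewrite subr_eq0 => /eqP wl; move: wab.
    by rewrite wl fE toC_lt ltxx.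
  exists (d / 2 / 2); split; first by rewrite !divr_gt0.
  by move=> w; rewrite -splitr => wab w0; apply: nol; exists w.
have onb c : nbhs (texp c) (texp @` ball c (toC e)).
  apply: open_nbhs_nbhs; split; first by apply: texp_open; exact: ball_open.
  by exists c => //; apply: ballxx; rewrite toC_lt.
have [_ [[u ua <-] [v vb uv]]] := pq _ _ (onb _ a) (onb _ b).
apply: (eP (u - v)); last by rewrite texpB uv subrr.
move: ua vb; rewrite -!ball_normE /= => ua vb.
have tri : `|u - v - (a - b)| <= `|b - v| + `|a - u|.
  rewrite -[X in `|X| <= _](_ : b - v - (a - u) = _) ?ler_normB //.
  by apply/rowP => k; rewrite !mxE; ring.
by apply: (le_lt_trans tri); rewrite toCD ltrD.
Qed.

Lemma torsion_finite T n : (0 < n)%N -> finite_set [set x : T | x *+ n = 0].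
Proof.
have ltMn (a b : C) : (0 < n)%N -> a < b -> a *+ n < b *+ n.
  by move=> n0 ab; rewrite ltrMn2r n0.
move=> n0; have [_ /toC_gt0P[d d0 ->] dP] := (nbhs_ballP _ _).1 (@texp_discrete R T).
(* For two n-torsion points with lifts in a ball of radius e, n times the difference of the lifts is
   a lattice vector shorter than 2 n e = d, hence 0. *)
pose e := d / (2 * n%:R).
have e0 : 0 < e by rewrite divr_gt0 // mulr_gt0 // ltr0n.
pose U (v : 'rV[C]_(tdim T)) := texp @` ball v (toC e) : set T.
have U1 v x y : U v x -> U v y -> x *+ n = 0 -> y *+ n = 0 -> x = y.
  move=> [u + <-] [w + <-]; rewrite -!ball_normE /= => vu vw un wn.
  have tri : `|(u - w) *+ n| <= (`|v - w| + `|v - u|) *+ n.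
    rewrite normrMn lerMn2r -[X in `|X| <= _](_ : v - w - (v - u) = _) ?ler_normB ?orbT //.
    by apply/rowP => k; rewrite !mxE; ring.
  have uw : (u - w) *+ n = 0.
    apply: dP; last by rewrite texpMn texpB mulrnBl un wn subrr.
    rewrite -ball_normE /= sub0r normrN; apply: (le_lt_trans tri).
    have -> : toC d = (toC e + toC e) *+ n.
      rewrite -toCD /toC -rmorphMn /=; congr (_ %:C)%C.
      by rewrite -mulr_natr /e; field; rewrite pnatr_eq0 -lt0n.
    by apply: ltMn => //; rewrite ltrD.
  suff uw0 : u - w = 0 by rewrite (subr0_eq uw0).
  have : (n%:R : C) *: (u - w) = 0 by rewrite scaler_nat.
  by move/eqP; rewrite scaler_eq0 pnatr_eq0 gtn_eqF // => /eqP.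
(* F is the filter of the sets of subsets of T that contain every large enough
   finite set; each x has a neighbourhood with at most one torsion point. *)
pose F : set_system (set T) := fun Q =>
  exists2 D0, finite_set D0 & forall D, finite_set D -> D0 `<=` D -> Q D.
have FF : Filter F.
  split.
  - by exists set0.
  - move=> P Q [D1 f1 P1] [D2 f2 Q2]; exists (D1 `|` D2); first by rewrite finite_setU.
    by move=> D fD; rewrite subUset => -[D1D D2D]; split; [apply: P1|apply: Q2].
  - by move=> P Q PQ [D1 f1 P1]; exists D1 => // D fD D1D; apply/PQ/P1.
have /compact_near_coveringP/(_ _ F (fun D x => x *+ n = 0 -> D x) FF) := @torus_compact R T.
case=> [x _|D fD DP].
  have [v xE] := texp_surj x.
  have oU : nbhs x (U v).
    apply: open_nbhs_nbhs; split; first by apply: texp_open; exact: ball_open.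
    by exists v => //; apply: ballxx; rewrite toC_lt.
  have [[y [Uy yn]]|no] := pselect (exists y, U v y /\ y *+ n = 0).
    exists (U v, [set D : set T | D y]) => /=.
      by split => //; exists [set y] => // D _; apply.
    by move=> [x' D] /= [Ux' Dy] x'n; rewrite (U1 v x' y).
  exists (U v, setT); first by split => //; exists set0.
  by move=> [x' D] /= [Ux' _] x'n; case: no; exists x'.
by apply: (sub_finite_set _ fD) => x; exact: DP.
Qed.

(* The kernel of N is a finite union of translates of the closed set E(S') by
   n-torsion points, so that E(S') is open and closed in the component of 0. *)
Lemma component_image S' S T (E : S' -> S) (N : S -> T) n :
  (0 < n)%N -> lin_hom E -> (forall x, N (E x) = 0) ->
  (forall y, N y = 0 -> exists x, y *+ n = E x) ->
  connected_component [set x | N x = 0] 0 = E @` setT.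
Proof.
move=> n0 Elin NE EN.
have E0 := lin_hom0 Elin.
have cE := lin_hom_continuous Elin.
have clE : closed (range E).
  apply: compact_closed; first exact: torus_hausdorff.
  apply: continuous_compact; last exact: torus_compact.
  exact: continuous_subspaceT.
apply/seteqP; split => [y|_ [x _ <-]].
  have cc := @component_connected _ [set x | N x = 0] 0.
  set K := connected_component _ _ in cc * => Ky.
  have K0 : K 0 by apply: connected_component_refl => /=; rewrite -E0 NE.
  have KN x : K x -> N x = 0 by move/connected_component_sub.
  (* The translates by torsion points outside the image. If n x = E w and w = n w', then x lies in
     the translate by x - E w'. *)
  pose Z := \bigcup_(t in [set t : S | t *+ n = 0] `\` range E)
    ((fun x => x - t) @^-1` range E).
  have clZ : closed Z.
    apply: closed_bigcup => [|t _]; first exact/finite_setD/torsion_finite.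
    by apply: closed_comp clE => x _; apply: torus_shift_continuous.
  have KZ x : K x -> range E x <-> ~ Z x.
    move=> Kx; split => [[u _ <-] [t [tn tE] [w _ wE]]|nZ].
      by apply: tE; exists (u - w) => //; rewrite (lin_homB Elin) wE opprB addrC subrK.
    have [w wE] := EN _ (KN _ Kx); have [w' w'E] := torus_divisible w n0.
    have tn : (x - E w') *+ n = 0.
      by rewrite mulrnBl wE -w'E (lin_homMn Elin) subrr.
    have [tE|tE] := pselect (range E (x - E w')).
      have [u _ uE] := tE; exists (u + w') => //.
      by rewrite (lin_homD Elin) uE subrK.
    by case: nZ; exists (x - E w') => //=; exists w' => //; rewrite opprB addrC subrK.
  suff KE : K `&` range E = K by move: Ky; rewrite -KE => -[].
  apply: cc.
  - by exists 0; split => //; exists 0.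
  - exists (~` Z); first exact: closed_openC.
    by apply/seteqP; split => x [Kx]; [move/(KZ _ Kx)|move=> nZ; split=> //; apply/(KZ _ Kx)].
  - by exists (range E).
(* The image of the segment from 0 to v joins 0 to E x inside the kernel. *)
have [v <-] := texp_surj x.
pose p (t : R) := E (texp (toC t *: v)).
apply: (@connected_component_max _ _ (p @` `[0, 1])).
- by exists 0; rewrite /= ?in_itv /= ?lexx ?ler01 // /p toC0 scale0r texp0 E0.
- by move=> _ [t _ <-] /=; rewrite /p NE.
- apply: connected_continuous_connected; first exact: segment_connected.
  apply: continuous_subspaceT => t.
  have c1 : (toC s *: v) @[s --> t] --> toC t *: v by apply: cvgZr_tmp; apply: toC_continuous.
  exact: cvg_comp _ _ (cvg_comp _ _ c1 (@texp_continuous R S' _)) (cE _).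
by exists 1; rewrite /= ?in_itv /= ?lexx ?ler01 // /p toC1 scale1r.
Qed.

End TorusBasics.

(** * Curves and their Jacobians *)

(** The level set of D through x0 is open and closed in A. *)
Lemma connected_locally_cst (X : topologicalType) (T : Type) (A : set X) (D : X -> T) :
  connected A ->
  (forall x, A x -> \forall y \near x, A y -> D y = D x) ->
  forall x y, A x -> A y -> D x = D y.
Proof.
move=> cA loc x0 y0 Ax0 Ay0.
have : A `&` [set y | D y = D x0] = A.
  apply: cA; first by exists x0.
  - exists (interior [set z | A z -> D z = D x0]); first exact: open_interior.
    apply/seteqP; split => z [Az] /=.
      by move=> <-; split => //; exact: loc.
    by move=> /interior_subset /(_ Az).
  - exists (~` interior [set z | A z -> D z <> D x0]).
      exact/open_closedC/open_interior.
    apply/seteqP; split => z [Az] /=.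
      by move=> zx; split => // /interior_subset /(_ Az).
    move=> nz; split => //=; apply: contrapT => zx; apply: nz.
    by apply: filterS (loc _ Az) => u + Au => ->.
by move=> /seteqP[_ /(_ _ Ay0)[_ ->]].
Qed.

(* Over an abstract K the two topologies on K, as a numFieldType and as a
   normed module, are identified at once; over C R this is very slow. *)
Section OneVariable.
Context {K : numFieldType} {E E' : normedModType K}.

Lemma near_differentiable_cvg (g : K -> E) (a : K) :
  (\forall z \near a, differentiable g z) -> g z @[z --> a] --> g a.
Proof. by move=> /nbhs_singleton/differentiable_continuous. Qed.

Lemma near_differentiable_comp (t : K -> K) (g : K -> E) (a : K) :
  (\forall z \near a, differentiable t z) ->
  (\forall z \near t a, differentiable g z) ->
  \forall z \near a, differentiable (g \o t) z.
Proof.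
move=> td gd; have tc := differentiable_continuous (nbhs_singleton td).
by apply: filterS2 td (tc _ gd) => z tz gz; exact: differentiable_comp.
Qed.

Lemma near_differentiable_post (g : K -> E) (k : E -> E') (a : K) :
  (\forall z \near a, differentiable g z) ->
  (forall z, differentiable k z) -> \forall z \near a, differentiable (k \o g) z.
Proof. by move=> gd kd; apply: filterS gd => z gz; apply: differentiable_comp. Qed.

Lemma near_is_derive (f g : K -> K) (a b : K) :
  (\forall z \near a, f z = g z) -> is_derive a 1 f b -> is_derive a 1 g b.
Proof. exact: near_eq_is_derive. Qed.

Lemma near_differentiable_is_derive (g : K -> K) (a : K) :
  (\forall z \near a, differentiable g z) -> is_derive a 1 g ('D_1 g a).
Proof. by move=> gd; apply: derivableP; apply/diff_derivable/(nbhs_singleton gd). Qed.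

Lemma is_derive1B (f g : K -> K) (a b b' : K) :
  is_derive a 1 f b -> is_derive a 1 g b' -> is_derive a 1 (fun z => f z - g z) (b - b').
Proof. exact: is_deriveB. Qed.

Lemma near_differentiable_id (a : K) : \forall z \near a, differentiable (@id K) z.
Proof. by apply: (filterE (F := nbhs a)). Qed.

Lemma near_differentiable_cst (v : E) (a : K) :
  \forall z \near a, differentiable (cst v : K -> E) z.
Proof. by apply: (filterE (F := nbhs a)) => z; exact: differentiable_cst. Qed.

Lemma near_differentiableD (f g : K -> E) (a : K) :
  (\forall z \near a, differentiable f z) -> (\forall z \near a, differentiable g z) ->
  \forall z \near a, differentiable (f + g) z.
Proof. by move=> fd gd; apply: filterS2 fd gd => z dz dz'; exact: differentiableD. Qed.

End OneVariable.

Lemma near_differentiable_rV {K : numFieldType} n (g : 'I_n -> K -> K) (a : K) :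
  (forall k, \forall z \near a, differentiable (g k) z) ->
  \forall z \near a, differentiable (fun z => \row_k g k z : 'rV[K]_n) z.
Proof.
move=> gd; have dg : \forall z \near a, forall k, differentiable (g k) z.
  exact: (@filter_forall _ _ _ (nbhs a) (nbhs_filter a)).
apply: filterS dg => z dz; apply: differentiable_rV => k.
by rewrite (_ : (fun y => _) = g k) //; apply/funext => y; rewrite mxE.
Qed.

Lemma nbhs_preimage (S T : topologicalType) (f : S -> T) (x : S) (y : T) (A : set T) :
  f z @[z --> x] --> y -> nbhs y A -> nbhs x (f @^-1` A).
Proof. by move=> h; apply: h. Qed.

Section CurveAnalysis.
Context {R : realType}.
Implicit Types X Y : curve R.
Local Notation C := (C R).

Lemma chart_continuous X (c : chart R X) x : atlas c -> c.1 x ->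
  c.2 @ x --> c.2 x.
Proof. by move=> /atlas_homeo[_ _ + _] cx => /(_ x); apply; rewrite inE. Qed.

Lemma chart_nbhs X (c : chart R X) x : atlas c -> c.1 x -> nbhs x c.1.
Proof. by move=> /atlas_homeo[oc _ _ _] cx; apply: open_nbhs_nbhs. Qed.

Lemma chart_image X (c : chart R X) x (U : set X) : atlas c -> c.1 x ->
  nbhs x U -> nbhs (c.2 x) (c.2 @` (U `&` c.1)).
Proof.
move=> ac cx xU; have [oc _ _ oim] := atlas_homeo ac.
have oI : open (interior U `&` c.1) by apply: openI => //; exact: open_interior.
apply: (@filterS _ (nbhs (c.2 x)) _ (c.2 @` (interior U `&` c.1))).
  by move=> _ [y [yU cy] <-]; exists y => //; split => //; exact: interior_subset.
by apply: open_nbhs_nbhs; split; [apply: oim => // y []|exists x].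
Qed.

Lemma hol_in_chart_chg X (E : normedModType C) (c d : chart R X) (f : X -> E) x :
  atlas c -> atlas d -> c.1 x -> d.1 x -> hol_in_chart c f x -> hol_in_chart d f x.
Proof.
move=> ac ad cx dx [g gd gE].
have [t [td tE]] : exists t : C -> C, (\forall z \near d.2 x, differentiable t z) /\
    \forall y \near x, c.2 y = t (d.2 y).
  by have [t td tE] := atlas_compat ad ac dx cx; exists t.
have tx := nbhs_singleton tE; rewrite tx in gd.
exists (g \o t); first exact: near_differentiable_comp.
by apply: filterS2 gE tE => y -> /= ->.
Qed.

Lemma hol_at_chart X (E : normedModType C) (d : chart R X) (f : X -> E) x :
  hol_at f x -> atlas d -> d.1 x -> hol_in_chart d f x.
Proof. by move=> [c ac [cx hc]] ad dx; exact: hol_in_chart_chg hc. Qed.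

Lemma hol_at_cont X (E : normedModType C) (f : X -> E) x :
  hol_at f x -> f @ x --> f x.
Proof.
move=> [c ac [cx [g gd gE]]].
have gx := nbhs_singleton gE.
have gc : g @ c.2 x --> f x.
  by rewrite gx; exact: near_differentiable_cvg.
apply: cvg_trans (cvg_comp _ _ (chart_continuous ac cx) gc).
by apply: near_eq_cvg; apply: filterS gE => y ->.
Qed.

Lemma hol_at_near X (E : normedModType C) (f : X -> E) x :
  hol_at f x -> \forall y \near x, hol_at f y.
Proof.
move=> [c ac [cx [g gd gE]]].
have gd' : \forall y \near x, \forall z \near c.2 y, differentiable g z.
  have gd2 : nbhs (c.2 x) [set w | \forall z \near w, differentiable g z].
    exact: nbhs_interior gd.
  exact: (nbhs_preimage (chart_continuous ac cx) gd2).
have gE' : \forall y \near x, \forall z \near y, f z = g (c.2 z).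
  exact: nbhs_interior gE.
have cn := chart_nbhs ac cx.
apply: filterS3 gd' gE' cn => y y1 y2 y3.
by exists c => //; split => //; exists g.
Qed.

Lemma hol_at_diff X (E E' : normedModType C) (f : X -> E) (k : E -> E') x :
  hol_at f x -> (forall z, differentiable k z) -> hol_at (k \o f) x.
Proof.
move=> [c ac [cx [g gd gE]]] kd; exists c => //; split => //; exists (k \o g).
  exact: near_differentiable_post.
by apply: filterS gE => y /= ->.
Qed.

Lemma hol_at_eq X (E : normedModType C) (f f' : X -> E) x :
  (\forall y \near x, f y = f' y) -> hol_at f x -> hol_at f' x.
Proof.
move=> ff [c ac [cx [g gd gE]]]; exists c => //; split => //; exists g => //.
by apply: filterS2 ff gE => y <-.
Qed.

Lemma hol_at_rV X n (f : X -> 'rV[C]_n) x :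
  (forall k, hol_at (fun y => f y 0 k : C) x) -> hol_at f x.
Proof.
move=> fk; have [c ac cx] := atlas_cover x.
have hk k := hol_at_chart (fk k) ac cx.
pose g k := projT1 (cid2 (hk k)).
exists c => //; split => //; exists (fun z => \row_k g k z).
  by apply: near_differentiable_rV => k; rewrite /g; case: cid2.
have : \forall y \near x, forall k, f y 0 k = g k (c.2 y).
  by apply: filter_forall => k; rewrite /g; case: cid2.
by apply: filterS => y fy; apply/rowP => k; rewrite mxE fy.
Qed.

Lemma is_coef_eq X (c : chart R X) (F G : X -> C) x a :
  (\forall y \near x, F y = G y) -> is_coef c F x a -> is_coef c G x a.
Proof.
by move=> FG [g ga gE]; exists g => //; apply: filterS2 FG gE => y <-.
Qed.

Lemma is_coefB X (c : chart R X) (F G : X -> C) x a b :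
  is_coef c F x a -> is_coef c G x b -> is_coef c (fun y => F y - G y) x (a - b).
Proof.
move=> [g ga gE] [k kb kE]; exists (fun z => g z - k z); first exact: is_derive1B.
by apply: filterS2 gE kE => y -> ->.
Qed.

Lemma is_coef_cst X (c : chart R X) (F : X -> C) x v :
  (\forall y \near x, F y = v) -> is_coef c F x 0.
Proof. by move=> Fv; exists (cst v) => //; exact: is_derive_cst. Qed.

Lemma hol_is_coef X (c : chart R X) (F : X -> C) x : hol_at F x ->
  atlas c -> c.1 x -> exists a, is_coef c F x a.
Proof.
move=> Fx ac cx; have [g gd gE] := hol_at_chart Fx ac cx.
by exists ('D_1 g (c.2 x)), g => //; exact: near_differentiable_is_derive.
Qed.

(** Read in a chart, F has derivative 0 on a ball, so [cst_on_ball] applies. In [inv], the point x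
    is only a default value. *)
Lemma zero_coef_cst X (F : X -> C) x :
  (\forall y \near x, forall c, atlas c -> c.1 y -> is_coef c F y 0) ->
  \forall y \near x, F y = F x.
Proof.
move=> F0; have [c ac cx] := atlas_cover x.
have [oc cinj _ _] := atlas_homeo ac.
pose inv z := xget x [set y | c.1 y /\ c.2 y = z].
have invE y : c.1 y -> inv (c.2 y) = y.
  move=> cy; rewrite /inv; case: xgetP => [y' -> [cy' e]|/(_ y)]; last by case.
  by apply: cinj; rewrite ?inE.
pose G z := F (inv z).
have [e e0 eP] := (nbhs_ballP _ _).1 (chart_image ac cx F0).
have Gcst : forall z, ball (c.2 x) e z -> G z = G (c.2 x).
  apply: cst_on_ball => z /eP[y [Fy cy] <-].
  have [g g0 gE] := Fy c ac cy.
  apply: near_is_derive g0.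
  apply: filterS (chart_image ac cy gE) => _ [y' [y'E cy'] <-].
  by rewrite /G invE.
have cb : \forall y \near x, ball (c.2 x) e (c.2 y).
  have bn : nbhs (c.2 x) (ball (c.2 x) e) by exact: nbhsx_ballx.
  exact: (nbhs_preimage (chart_continuous ac cx) bn).
apply: filterS2 cb (chart_nbhs ac cx) => y yb cy.
by have := Gcst _ yb; rewrite /G !invE.
Qed.

End CurveAnalysis.

(** * The universal property of the Abel-Jacobi map *)

Section UniversalProperty.
Context {R : realType}.
Local Notation C := (C R).

Lemma mulmx_entryB n (u v : 'rV[C]_n) (l : 'cV[C]_n) :
  ((u - v) *m l) 0 0 = (u *m l) 0 0 - (v *m l) 0 0.
Proof. by rewrite mulmxBl mxE; congr (_ + _); rewrite mxE. Qed.

Lemma row_entryB n (u v : 'rV[C]_n) k : (u - v) 0 k = u 0 k - v 0 k.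
Proof. by rewrite mxE; congr (_ + _); rewrite mxE. Qed.

Lemma shift_mulmx n m (u : 'rV[C]_m) (w v : 'rV[C]_n) (L : 'M[C]_(n, m)) :
  u - v *m L = (u - w *m L) + (w - v) *m L.
Proof. by rewrite mulmxBl addrA subrK. Qed.

Section Lifts.
Context (X : curve R) (T : torus R).
Implicit Types (h : X -> T) (f : X -> 'rV[C]_(tdim T)).

Lemma local_lift_near h f x : local_lift h f x -> \forall y \near x, local_lift h f y.
Proof.
move=> [hf fE]; have := filterI (hol_at_near hf) (nbhs_interior fE).
by move=> H; apply: filterS (H _) => y [].
Qed.

Lemma local_lift_diff h f f' x : local_lift h f x -> local_lift h f' x ->
  \forall y \near x, f y - f' y = f x - f' x.
Proof.
move=> [hf fE] [hf' fE'].
apply: (texp_cst_near (nbhs_filter x)).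
  by apply: cvgB; exact: hol_at_cont.
have e : texp (f x) = texp (f' x).
  by rewrite -(nbhs_singleton fE) -(nbhs_singleton fE').
have H : \forall y \near x, texp (f y) = texp (f' y).
  by apply: filterS2 fE fE' => y <- <-.
by apply: filterS H => y yE; rewrite !texpB yE e !subrr.
Qed.

Lemma hol_at_linear (f : X -> 'rV[C]_(tdim T)) m (L : 'M[C]_(tdim T, m)) x :
  hol_at f x -> hol_at (fun y => f y *m L) x.
Proof.
move=> hf; apply: (@hol_at_diff _ _ _ _ f (fun v => v *m L) x hf) => z.
by apply: differentiable_mulmxr.
Qed.

Lemma hol_at_coord n (f : X -> 'rV[C]_n) k x :
  hol_at f x -> hol_at (fun y => f y 0 k : C) x.
Proof.
move=> hf; apply: (@hol_at_diff _ _ _ _ f (fun v => v 0 k : C) x hf) => z.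
by apply: differentiable_coord.
Qed.

(** The form h^* l. Any local lift gives the same coefficient, since two of them differ by a
    constant; 0 is a junk value. *)
Definition pull_form h (l : 'cV[C]_(tdim T)) : Defs.form X := fun c y =>
  xget 0 [set a | exists2 f, local_lift h f y &
    is_coef c (fun z => (f z *m l) 0 0 : C) y a].

Lemma pull_formP h l f x : local_lift h f x ->
  is_differential (fun y => (f y *m l) 0 0 : C) (pull_form h l) x.
Proof.
move=> /local_lift_near; apply: filterS => y lf c ac cy.
have [hf fE] := lf.
have [a fa] := hol_is_coef (hol_at_coord 0 (hol_at_linear l hf)) ac cy.
rewrite /pull_form; case: xgetP => [b -> [f' lf' fb]|/(_ a)]; last first.
  by case; exists f.
have d0 : is_coef c (fun z => (f' z *m l) 0 0 - (f z *m l) 0 0 : C) y 0.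
  apply: (@is_coef_cst _ _ _ _ _ (((f' y - f y) *m l) 0 0)).
  apply: filterS (local_lift_diff lf' lf) => z <-.
  by rewrite mulmx_entryB.
have := is_coefB fb d0; rewrite subr0; apply: is_coef_eq.
by apply: nearW => z; rewrite opprB addrC subrK.
Qed.

Lemma pull_form_hol h l : (forall x, exists f, local_lift h f x) ->
  hol_form (pull_form h l).
Proof.
move=> hl x; have [f lf] := hl x.
by exists (fun y => (f y *m l) 0 0 : C); exact: pull_formP.
Qed.

End Lifts.

Lemma is_differential_diff (X : curve R) (F G : X -> C) (w : Defs.form X) x :
  is_differential F w x -> is_differential G w x ->
  \forall y \near x, F y - G y = F x - G x.
Proof.
move=> dF dG; apply: zero_coef_cst.
apply: filterS2 dF dG => y Fy Gy c ac cy.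
by have := is_coefB (Fy c ac cy) (Gy c ac cy); rewrite subrr.
Qed.

Section Albanese.
Context (X : curve R) (JX : jacobian_torus X) (T : torus R).
Local Notation alpha := (abel_jacobi JX).

(** The k-th column of L is the invariant form on JX whose pullback by alpha is the pullback by h of
    the k-th coordinate form. Hence phi and f L have the same differential. *)
Lemma albanese_matrix (h : X -> T) : (forall x, exists f, local_lift h f x) ->
  exists L : 'M[C]_(tdim JX, tdim T), forall x f phi,
    local_lift alpha f x -> local_lift h phi x ->
    \forall y \near x, phi y - f y *m L = phi x - f x *m L.
Proof.
move=> hl.
have lP (k : 'I_(tdim T)) : exists l, is_pullback alpha l (pull_form h (delta_mx k 0)).
  by have [l [lP _]] := jac_forms JX (pull_form_hol (delta_mx k 0) hl); exists l.
pose l (k : 'I_(tdim T)) := projT1 (cid (lP k)).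
exists (\matrix_(r, k) l k r 0) => x f phi lf lphi.
have Lk (v : 'rV[C]_(tdim JX)) k : (v *m \matrix_(r, k) l k r 0) 0 k = (v *m l k) 0 0.
  by rewrite !mxE; apply: eq_bigr => r _; rewrite mxE.
have phik (v : 'rV[C]_(tdim T)) (k : 'I_(tdim T)) : (v *m delta_mx k 0) 0 0 = v 0 k :> C.
  rewrite mxE (bigD1 k) //= mxE !eqxx mulr1 big1 ?addr0 // => r /negbTE rk.
  by rewrite mxE rk mulr0.
have coord k : \forall y \near x,
    phi y 0 k - (f y *m l k) 0 0 = phi x 0 k - (f x *m l k) 0 0.
  have lk : is_pullback alpha (l k) (pull_form h (delta_mx k 0)) by exact: projT2 (cid (lP k)).
  have [fk lfk dfk] := lk x.
  have d1 := is_differential_diff (pull_formP (delta_mx k 0) lphi) dfk.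
  have d2 := local_lift_diff lf lfk.
  apply: filterS2 d1 d2 => y; rewrite !phik => e1 e2.
  have e3 : (f y *m l k) 0 0 - (fk y *m l k) 0 0 = (f x *m l k) 0 0 - (fk x *m l k) 0 0.
    by rewrite -!mulmx_entryB e2.
  have sub3 (a b c : C) : a - b = (a - c) - (b - c) by rewrite opprB addrA subrK.
  by rewrite (sub3 _ _ ((fk y *m l k) 0 0)) e1 e3 -sub3.
have H := @filter_forall _ _ _ (nbhs x) (nbhs_filter x) coord.
by apply: filterS H => y yk; apply/rowP => k;
  rewrite [LHS]row_entryB [RHS]row_entryB !Lk; exact: yk.
Qed.

(* A lift of h along a loop differs by a constant from the image under L of a
   lift of alpha, so that L maps periods into the lattice of T. *)
Lemma albanese (h : X -> T) : (forall x, exists f, local_lift h f x) ->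
  exists H : JX -> T, lin_hom H /\
    forall p q, H (alpha p - alpha q) = h p - h q.
Proof.
move=> hl; have [L LP] := albanese_matrix hl.
have al := @abel_jacobi_hol R X JX.
have kerL v : texp v = 0 -> texp (v *m L) = 0.
  move=> /jac_periods[gamma [lift [[gc g01] lc lE ->]]].
  have I0 : `[0, 1]%classic (0 : R) by rewrite /= in_itv /= lexx ler01.
  have I1 : `[0, 1]%classic (1 : R) by rewrite /= in_itv /= lexx ler01.
  (* D is locally constant on [0, 1]. As gamma is closed, D 0 = D 1 says that the end points of the
     lift have images under L that agree in T. *)
  pose D t := h (gamma t) - texp (lift t *m L).
  have DE : D 0 = D 1.
    apply: (connected_locally_cst (@segment_connected R 0 1)) => // t It.
    have [f lf] := al (gamma t); have [phi lphi] := hl (gamma t).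
    pose W := within `[0, 1]%classic (nbhs t).
    have FW : Filter W by exact: within_filter.
    have gW : gamma @ W --> gamma t.
      exact: ((@subspace_continuousP R `[0, 1]%classic X gamma).1 gc).
    have lW : lift @ W --> lift t.
      exact: ((@subspace_continuousP R `[0, 1]%classic _ lift).1 lc).
    have fl : \forall s \near W, f (gamma s) - lift s = f (gamma t) - lift t.
      apply: (@texp_cst_near _ JX _ W (fun s => f (gamma s) - lift s)).
        exact: (cvgB (cvg_comp _ _ gW (hol_at_cont lf.1)) lW).
      have fE : \forall s \near W, alpha (gamma s) = texp (f (gamma s)).
        exact: gW _ lf.2.
      have IW : \forall s \near W, `[0, 1]%classic s by exact: near_withinT.
      apply: filterS2 fE IW => s sE Is; rewrite !texpB -sE -!lE // -(nbhs_singleton lf.2).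
      by rewrite !subrr.
    have phiL : \forall s \near W, phi (gamma s) - f (gamma s) *m L
        = phi (gamma t) - f (gamma t) *m L.
      exact: gW _ (LP _ _ _ lf lphi).
    have phiE : \forall s \near W, h (gamma s) = texp (phi (gamma s)).
      exact: gW _ lphi.2.
    have e0 : h (gamma t) = texp (phi (gamma t)) by exact: nbhs_singleton lphi.2.
    suff : \forall s \near W, D s = D t by rewrite /W near_withinE.
    apply: filterS3 fl phiL phiE => s e1 e2 e3.
    have E : phi (gamma s) - lift s *m L = phi (gamma t) - lift t *m L.
      by rewrite (shift_mulmx _ (f (gamma s))) e2 e1 -shift_mulmx.
    by rewrite /D e3 e0 -texpB E texpB.
  move: DE; rewrite /D g01 => /addrI /oppr_inj e.
  by rewrite mulmxBl texpB e subrr.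
(* By [kerL], the choice of the preimage of x does not matter. *)
pose H x := texp (projT1 (cid (texp_surj x)) *m L).
have HE v : H (texp v) = texp (v *m L).
  rewrite /H; case: cid => w /= wv; apply/eqP; rewrite -subr_eq0 -texpB -mulmxBl.
  by apply/eqP/kerL; rewrite texpB wv subrr.
have Hlin : lin_hom H by exists L.
exists H; split => // p q.
rewrite (lin_homB Hlin).
suff E : h p - H (alpha p) = h q - H (alpha q).
  have -> : H (alpha p) = h p - (h q - H (alpha q)) by rewrite -E opprB addrC subrK.
  by rewrite opprB addrA addrAC addrK.
have cst := @connected_locally_cst X T setT (fun x => h x - H (alpha x))
  (@curve_connected R X).
apply: cst => // x _; have [f lf] := al x; have [phi lphi] := hl x.
have := filterS3 _ _ lf.2 lphi.2 (LP _ _ _ lf lphi); apply => y e1 e2 e3 _.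
rewrite e1 e2 (nbhs_singleton lf.2) (nbhs_singleton lphi.2) !HE -!texpB.
by rewrite e3.
Qed.

(** Let L be the matrix of H - H'. Since H - H' kills all differences of values of alpha, f L is
    locally constant for every local lift f of alpha. So the columns of L pull back to the form 0,
    and uniqueness in [jac_forms] gives L = 0. *)
Lemma albanese_unique (H H' : JX -> T) : lin_hom H -> lin_hom H' ->
  (forall p q, H (alpha p - alpha q) = H' (alpha p - alpha q)) -> H =1 H'.
Proof.
move=> hH hH' HH; have [L LE] := lin_hom_sub hH hH'.
suff L0 : L = 0.
  move=> x; have [v <-] := texp_surj x; apply/eqP.
  by rewrite -subr_eq0 LE L0 mulmx0 texp0.
have al := @abel_jacobi_hol R X JX.
pose o : Defs.form X := fun _ _ => 0.
have w0 : hol_form o.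
  by move=> x; exists (fun _ => 0); apply: nearW => y c _ _;
     apply: (@is_coef_cst _ _ _ _ _ 0); exact: nearW.
have [l0 [_ l0u]] := jac_forms JX w0.
have pb l : (forall x f, local_lift alpha f x ->
    \forall y \near x, (f y *m l) 0 0 = (f x *m l) 0 0 :> C) ->
    is_pullback alpha l o.
  move=> lcst x; have [f lf] := al x; exists f => //.
  apply: filterS (local_lift_near lf) => y lfy c _ _.
  exact: is_coef_cst (lcst _ _ lfy).
have colE k : col k L = 0.
  have c0 : is_pullback alpha 0 o.
    by apply: pb => x f lf; apply: nearW => y; rewrite !mulmx0.
  suff ck : is_pullback alpha (col k L) o by rewrite -(l0u _ ck) (l0u _ c0).
  apply: pb => x f lf.
  have fL : \forall y \near x, f y *m L = f x *m L.
    apply: (@texp_cst_near _ T _ (nbhs x) (fun y => f y *m L)).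
      exact: hol_at_cont (hol_at_linear L lf.1).
    apply: filterS lf.2 => y yE.
    rewrite -!LE -yE -(nbhs_singleton lf.2) -(subrK (alpha x) (alpha y)).
    by rewrite (lin_homD hH) (lin_homD hH') HH opprD addrACA subrr add0r.
  apply: filterS fL => y fyE.
  by rewrite !colE !mulmxA fyE.
by apply/matrixP => r k; have /colP/(_ r) := colE k; rewrite !mxE.
Qed.

End Albanese.
End UniversalProperty.

(** * Norm and pullback maps of a quotient *)

Section Norms.
Context {R : realType}.
Local Notation C := (C R).
Implicit Types X Y Z : curve R.

Lemma hol_at_comp X Y (E : normedModType C) (f : X -> Y) (phi : Y -> E) x :
  hol_map f -> hol_at phi (f x) -> hol_at (phi \o f) x.
Proof.
move=> [fc fh] [d ad [dx [g gd gE]]].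
have [c ac [cx [k [kd kE]]]] : exists2 c, atlas c & c.1 x /\ exists k : C -> C,
    (\forall z \near c.2 x, differentiable k z) /\ \forall y \near x, d.2 (f y) = k (c.2 y).
  by have [c ac [cx [k kd kE]]] := fh d ad x dx; exists c => //; split => //; exists k.
have e : d.2 (f x) = k (c.2 x) by exact: nbhs_singleton kE.
rewrite e in gd; exists c => //; split => //; exists (g \o k).
  exact: (near_differentiable_comp kd gd).
have gE' : \forall y \near x, phi (f y) = g (d.2 (f y)) by exact: (nbhs_preimage (fc x) gE).
by apply: filterS2 gE' kE => y /= -> ->.
Qed.

Lemma local_lift_comp X Y (T : torus R) (f : X -> Y) (h : Y -> T) phi x :
  hol_map f -> local_lift h phi (f x) -> local_lift (h \o f) (phi \o f) x.
Proof.
move=> hf [hphi phiE]; split; first exact: hol_at_comp.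
exact: (nbhs_preimage (hf.1 x) phiE).
Qed.

Section OneCurve.
Context X (T : torus R).

Lemma hol_at_cst (E : normedModType C) (v : E) (x : X) : hol_at (fun=> v) x.
Proof.
have [c ac cx] := atlas_cover x; exists c => //; split => //; exists (cst v).
  exact: near_differentiable_cst.
exact: nearW.
Qed.

Lemma hol_atD (E : normedModType C) (f f' : X -> E) x :
  hol_at f x -> hol_at f' x -> hol_at (fun y => f y + f' y) x.
Proof.
move=> [c ac [cx [g gd gE]]] /hol_at_chart/(_ ac cx)[g' gd' gE'].
exists c => //; split => //; exists (g + g').
  exact: near_differentiableD.
by apply: filterS2 gE gE' => y -> ->.
Qed.

Lemma local_lift_sum (I : Type) (s : seq I) (P : pred I) (h : I -> X -> T) x :
  (forall k, exists f, local_lift (h k) f x) ->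
  exists f, local_lift (fun y => \sum_(k <- s | P k) h k y) f x.
Proof.
move=> hl; elim: s => [|k s [f [fh fE]]].
  exists (fun=> 0); split; first exact: hol_at_cst.
  by apply: nearW => y; rewrite big_nil texp0.
have [fk [fkh fkE]] := hl k; case Pk : (P k); last first.
  by exists f; split => //; apply: filterS fE => y; rewrite big_cons Pk.
exists (fun y => fk y + f y); split; first exact: hol_atD.
by apply: filterS2 fE fkE => y; rewrite big_cons Pk texpD => -> ->.
Qed.

Lemma local_lift_continuous (h : X -> T) : (forall x, exists f, local_lift h f x) ->
  continuous h.
Proof.
move=> hl x; have [f [fh fE]] := hl x.
have c1 := cvg_comp _ _ (hol_at_cont fh) (@texp_continuous R T (f x)).
rewrite /continuous_at (nbhs_singleton fE); apply: cvg_trans c1.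
by apply: near_eq_cvg; apply: filterS fE => y /= ->.
Qed.

End OneCurve.

Section NormMap.
Context X Y (JX : jacobian_torus X) (JY : jacobian_torus Y).
Local Notation alpha := (abel_jacobi JX).
Local Notation beta := (abel_jacobi JY).

(** [albanese], applied to beta o f, provides a norm map, so the choice in [Nm] does not fall back
    on its default. *)
Lemma NmP (f : X -> Y) : hol_map f -> lin_hom (Nm JX JY f) /\
  forall p q, Nm JX JY f (alpha p - alpha q) = beta (f p) - beta (f q).
Proof.
move=> hf; suff [/torus_hom_lin] : is_norm_map f (Nm JX JY f) by [].
have hl x : exists phi, local_lift (beta \o f) phi x.
  have [phi lphi] := abel_jacobi_hol JY (f x).
  by exists (phi \o f); exact: local_lift_comp.
have [H [Hlin HE]] := albanese JX hl.
apply: (@xgetPex _ _ [set N | is_norm_map f N]); exists H; split => //.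
exact: lin_hom_torus_hom.
Qed.

Lemma Nm_lin (f : X -> Y) : hol_map f -> lin_hom (Nm JX JY f).
Proof. by move=> /NmP[]. Qed.

Lemma NmE (f : X -> Y) p q : hol_map f ->
  Nm JX JY f (alpha p - alpha q) = beta (f p) - beta (f q).
Proof. by move=> /NmP[_]. Qed.

End NormMap.

Lemma Nm_comp X Y Z (JX : jacobian_torus X) (JY : jacobian_torus Y)
    (JZ : jacobian_torus Z) (f : X -> Y) (k : Y -> Z) (l : X -> Z) :
  hol_map f -> hol_map k -> hol_map l -> (forall x, k (f x) = l x) ->
  forall x, Nm JY JZ k (Nm JX JY f x) = Nm JX JZ l x.
Proof.
move=> hf hk hl kf.
apply: (albanese_unique (JX := JX) (H := Nm JY JZ k \o Nm JX JY f)).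
- by apply: lin_hom_comp; exact: Nm_lin.
- exact: Nm_lin.
by move=> p q; rewrite /= !NmE // !kf.
Qed.

Lemma Nm_id X (JX : jacobian_torus X) (f : X -> X) : hol_map f -> (forall x, f x = x) ->
  forall x, Nm JX JX f x = x.
Proof.
move=> hf fE; apply: (albanese_unique (JX := JX) (H' := id)).
- exact: Nm_lin.
- exact: lin_hom_id.
by move=> p q; rewrite NmE // !fE.
Qed.

Section Quotient.
Context {gT : finGroupType} X Y (act : gT -> X -> X) (M : {group gT}) (q : X -> Y).
Hypothesis quo : is_quotient act M q.

Lemma quotient_hol_lift (n : nat) (f : Y -> 'rV[C]_n) y :
  (forall x, q x = y -> hol_at (f \o q) x) -> hol_at f y.
Proof.
move=> fq; have [_ _ _ qh] := quo; apply: hol_at_rV => k; apply/qh => x xy.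
exact: (hol_at_coord k (fq x xy)).
Qed.

Lemma quotient_hol_map : hol_map q.
Proof.
have [_ _ qo qh] := quo; split; first by apply/continuousP => B /qo.
move=> d ad x dx.
have hd : hol_at (d.2 : Y -> C) (q x).
  exists d => //; split => //; exists id.
    exact: near_differentiable_id.
  exact: nearW.
exact: ((qh _ _).1 hd).
Qed.

(** This makes the maps X_M -> Y holomorphic, which are given only by their composites with the
    quotient maps. *)
Lemma quotient_hol_factor Z (p : Y -> Z) (r : X -> Z) :
  hol_map r -> (forall x, p (q x) = r x) -> hol_map p.
Proof.
have [qs _ qo qh] := quo; move=> [rc rh] pq; split.
  apply/continuousP => B oB; apply/qo.
  rewrite (_ : _ @^-1` _ = r @^-1` B); first by move/continuousP: rc; apply.
  by apply/seteqP; split => x /=; rewrite pq.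
move=> d ad y dy; apply/qh => x xy.
have := rh d ad x; rewrite -pq xy => /(_ dy).
by apply: hol_at_eq; apply: nearW => z /=; rewrite pq.
Qed.

(** A local section of [texp] lifts h near y. Its holomorphy is tested on X, where it is a translate
    of a local lift of S. *)
Lemma quotient_lift (T : torus R) (S : X -> T) (h : Y -> T) :
  (forall x, exists f, local_lift S f x) -> (forall x, h (q x) = S x) ->
  forall y, exists f, local_lift h f y.
Proof.
move=> Sl hq y; have [qs _ qo qh] := quo.
have hc : continuous h.
  apply/continuousP => B oB; apply/qo.
  rewrite (_ : _ @^-1` _ = S @^-1` B).
    by have /continuousP := local_lift_continuous Sl; apply.
  by apply/seteqP; split => x /=; rewrite hq.
have [v0 v0E] := texp_surj (h y).
have [_ /toC_gt0P[d d0 ->] dP] := (nbhs_ballP _ _).1 (@texp_discrete R T).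
(* Two points of a ball of radius d / 2 are less than d apart, so [texp] is injective on B. *)
pose B : set 'rV[C]_(tdim T) := ball v0 (toC (d / 2)).
have Binj u v : B u -> B v -> texp u = texp v -> u = v.
  rewrite /B -!ball_normE /= => ub vb uv.
  have tri : `|u - v| <= `|v0 - v| + `|v0 - u|.
    rewrite -[X in `|X| <= _](_ : v0 - v - (v0 - u) = _) ?ler_normB //.
    by apply/rowP => k; rewrite !mxE; ring.
  have uv0 : u - v = 0; last by rewrite (subr0_eq uv0).
  apply: dP; last by rewrite texpB uv subrr.
  rewrite -ball_normE /= sub0r normrN; apply: (le_lt_trans tri).
  by rewrite [d]splitr toCD ltrD.
pose s (t : T) : 'rV[C]_(tdim T) := xget 0 [set v | B v /\ texp v = t].
have sE v : B v -> s (texp v) = v.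
  move=> Bv; rewrite /s; case: xgetP => [u _ [Bu uv]|/(_ v)]; last by case.
  exact: Binj.
have Bv0 : B v0 by apply: ballxx; rewrite toC_lt divr_gt0.
exists (s \o h); split; last first.
  have oB : nbhs (h y) (texp @` B).
    rewrite -v0E; apply: open_nbhs_nbhs; split; last by exists v0.
    by apply: texp_open; exact: ball_open.
  by apply: filterS (nbhs_preimage (hc y) oB) => y' /= [v Bv <-]; rewrite sE.
apply: quotient_hol_lift => x xy.
(* Near x, the lift composed with q is psi translated by the lattice vector v0 - psi x. *)
have [psi [psih psiE]] := Sl x.
have psic := hol_at_cont psih.
have near1 : \forall x' \near x, B (psi x' + (v0 - psi x)).
  have c1 : (psi x' + (v0 - psi x)) @[x' --> x] --> psi x + (v0 - psi x).
    exact: (cvgD psic (cvg_cst _)).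
  have E1 : psi x + (v0 - psi x) = v0 by rewrite addrC subrK.
  rewrite E1 in c1; apply: (nbhs_preimage c1).
  by apply: nbhsx_ballx; rewrite toC_lt divr_gt0.
have e0 : texp (v0 - psi x) = 0.
  by rewrite texpB v0E -xy hq (nbhs_singleton psiE) subrr.
apply: (@hol_at_eq _ _ _ (fun x' => psi x' + (v0 - psi x))).
  apply: filterS2 near1 psiE => x' Bx' x'E /=.
  have e1 : texp (psi x' + (v0 - psi x)) = h (q x') by rewrite texpD e0 addr0 -x'E hq.
  by rewrite -e1 sE.
by apply: hol_atD => //; exact: hol_at_cst.
Qed.

Hypothesis actX : curve_action act.

Lemma act_hol g : hol_map (act g).
Proof. by have [_ _ + _] := actX. Qed.

Lemma actM g h x : act (g * h)%g x = act g (act h x).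
Proof. by have [_ + _ _] := actX. Qed.

Variables (JX : jacobian_torus X) (JY : jacobian_torus Y).
Local Notation alpha := (abel_jacobi JX).
Local Notation beta := (abel_jacobi JY).
Local Notation N := (Nm JX JY q).
Local Notation sigma g := (Nm JX JX (act g)).

Lemma quotient_Nm_act g x : g \in M -> N (sigma g x) = N x.
Proof.
have [_ qorb _ _] := quo.
move=> gM; apply: Nm_comp; [exact: act_hol|exact: quotient_hol_map|exact: quotient_hol_map|].
by move=> y; apply/esym/qorb; exists g.
Qed.

(* P is the pullback q^*, which sends y to the sum of the points above it. *)
Lemma quotient_pullback : exists P : JY -> JX, [/\ lin_hom P,
  forall x, P (N x) = \sum_(g in M) sigma g x & forall y, N (P y) = y *+ #|M|].
Proof.
have [qs qorb _ _] := quo; have hq := quotient_hol_map.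
pose S x := \sum_(g in M) alpha (act g x).
have Sl x : exists f, local_lift S f x.
  apply: local_lift_sum => g; have [f lf] := abel_jacobi_hol JX (act g x).
  by exists (f \o act g); apply: local_lift_comp lf; exact: act_hol.
(* An arbitrary set-theoretic section: S is M-invariant, so S o sec o q = S. *)
pose sec y := projT1 (cid (qs y)).
have secE y : q (sec y) = y by rewrite /sec; case: cid.
have hS x : S (sec (q x)) = S x.
  have /esym/qorb[g gM <-] := secE (q x).
  rewrite /S (reindex_inj (mulIg g^-1)%g) /=; apply: eq_big => k.
    by rewrite groupMr // groupV.
  by move=> _; rewrite -actM mulgKV.
have [P [Plin PE]] := albanese JY (quotient_lift (h := S \o sec) Sl hS).
have PN x : P (N x) = \sum_(g in M) sigma g x.
  move: x; apply: (albanese_unique (JX := JX) (H := P \o N)).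
  - by apply: lin_hom_comp => //; exact: Nm_lin.
  - by apply: lin_hom_sum => g; apply: Nm_lin; exact: act_hol.
  move=> x x'; rewrite /= NmE // PE /= !hS /S -sumrB; apply: eq_bigr => g _.
  by rewrite NmE //; exact: act_hol.
exists P; split => // y.
move: y; apply: (albanese_unique (JX := JY) (H := N \o P)).
- by apply: lin_hom_comp => //; exact: Nm_lin.
- by apply: lin_hom_muln; exact: lin_hom_id.
(* Writing y = q (sec y) turns N P into N P N on JX, where the |M| summands agree because N sigma_g
   = N. *)
move=> y y'; rewrite /= -(secE y) -(secE y') -(NmE JX JY) // PN.
rewrite (lin_hom_big _ _ _ (Nm_lin JX JY hq)).
by rewrite (eq_bigr (fun=> N (alpha (sec y) - alpha (sec y')))) ?sumr_const // => g gM;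
   exact: quotient_Nm_act.
Qed.

End Quotient.
End Norms.

Section ActionNorms.
Context {R : realType} {gT : finGroupType} (X : curve R) (act : gT -> X -> X).
Hypothesis actX : curve_action act.
Variable JX : jacobian_torus X.
Local Notation sigma g := (Nm JX JX (act g)).

Lemma act_Nm_lin g : lin_hom (sigma g).
Proof. by apply: Nm_lin; exact: act_hol. Qed.

Lemma act_NmM g h x : sigma (g * h)%g x = sigma g (sigma h x).
Proof. by apply/esym/Nm_comp; try exact: act_hol; move=> y; rewrite (actM actX). Qed.

Lemma act_Nm1 x : sigma 1%g x = x.
Proof. by apply: Nm_id; [exact: act_hol|case: actX]. Qed.

End ActionNorms.

(** * Isotypical components *)

Section IsotypicalSums.
Context {R : realType} {gT : finGroupType} (J : torus R) (s : gT -> J -> J).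
Hypothesis s_lin : forall g, lin_hom (s g).
Hypothesis sM : forall g h x, s (g * h)%g x = s g (s h x).
Hypothesis s1 : forall x, s 1%g x = x.

Definition eps (a : gT -> int) (x : J) : J := \sum_g s g x *~ a g.

Lemma eps_lin a : lin_hom (eps a).
Proof.
apply: lin_hom_sum => g; case: (a g) => n; first exact: lin_hom_muln.
exact: lin_hom_opp (lin_hom_muln n.+1 (s_lin g)).
Qed.

Lemma eps_s chi h x : sign_char chi -> eps chi (s h x) = eps chi x *~ chi h.
Proof.
move=> [chiM chi1 chiS]; rewrite /eps mulrz_suml [LHS](reindex_inj (mulIg h^-1)%g) /=.
apply: eq_bigr => g _; rewrite -sM mulgKV -mulrzA; congr (_ *~ _).
have := chiM (g * h^-1)%g h; rewrite mulgKV => ->.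
by rewrite -mulrA; case: (chiS h) => ->; rewrite ?mulr1 ?mulrN1 ?opprK.
Qed.

Lemma s_eps chi h x : sign_char chi -> s h (eps chi x) = eps chi x *~ chi h.
Proof.
move=> [chiM chi1 chiS]; rewrite /eps (lin_hom_big _ _ _ (s_lin h)).
rewrite mulrz_suml [RHS](reindex_inj (mulgI h)) /=.
apply: eq_bigr => g _; rewrite (lin_homMz (s_lin h)) sM -mulrzA; congr (_ *~ _).
by rewrite chiM; case: (chiS h) => ->; rewrite ?mulr1 ?mul1r ?mulN1r ?mulrN1 ?opprK.
Qed.

(** eps_chi eps_psi = (\sum_g chi(g) psi(g)) eps_chi, and the sign character chi psi is nontrivial
    at l. *)
Lemma eps_orth chi psi l x : sign_char chi -> sign_char psi ->
  chi l * psi l = -1 -> eps chi (eps psi x) = 0.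
Proof.
move=> schi spsi cpl; rewrite {2}/eps (lin_hom_big _ _ _ (eps_lin chi)).
under eq_bigr => g _ do rewrite (lin_homMz (eps_lin chi)) (eps_s _ _ schi) -mulrzA.
rewrite -mulrz_sumr (@sign_char_sum0 _ (fun g => chi g * psi g) l) ?mulr0z //.
have [cM c1 cS] := schi; have [pM p1 pS] := spsi; split=> [g h||g].
- by rewrite cM pM mulrACA.
- by rewrite c1 p1 mulr1.
by case: (cS g) => ->; case: (pS g) => ->; rewrite ?mulr1 ?mulrN1 ?opprK; auto.
Qed.

Lemma eps_eq a b : a =1 b -> eps a =1 eps b.
Proof. by move=> ab x; apply: eq_bigr => g _; rewrite ab. Qed.

Lemma eps_mull (k : nat) a x : eps (fun g => k%:R * a g) x = eps a (x *+ k).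
Proof.
rewrite (lin_homMn (eps_lin a)) /eps -sumrMnl; apply: eq_bigr => g _.
by rewrite natz mulrC mulrzA -pmulrn.
Qed.

(** By divisibility, multiplying x by a positive integer does not change the image. Hence a
    component does not depend on m. *)
Lemma range_eps_scale (k k' : nat) a b : (0 < k)%N -> (0 < k')%N ->
  (forall g, k%:R * a g = k'%:R * b g) -> range (eps a) = range (eps b).
Proof.
have sub (m m' : nat) (c d : gT -> int) : (0 < m)%N ->
    (forall g, m%:R * c g = m'%:R * d g) -> range (eps c) `<=` range (eps d).
  move=> m0 cd _ [x _ <-]; have [y <-] := torus_divisible x m0.
  by rewrite -eps_mull (eps_eq cd) eps_mull; exists (y *+ m').
by move=> k0 k0' ab; apply/seteqP; split; [apply: (sub k k')|apply: (sub k' k)].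
Qed.

(** The element 1 - z of Z[G]; for z = -1, twice the unit of the factor of W. *)
Definition delta_diff (z g : gT) : int := (g == 1%g)%:R - (g == z)%:R.

Lemma eps_delta z x : eps (delta_diff z) x = x - s z x.
Proof.
have one y : \sum_g s g x *~ (g == y)%:R = s y x.
  rewrite (bigD1 y) //= eqxx mulr1z big1 ?addr0 // => g /negbTE ->.
  by rewrite mulr0z.
rewrite /eps /delta_diff; under eq_bigr do rewrite mulrzBr.
by rewrite sumrB !one s1.
Qed.

Lemma eps_delta_eps chi z x : sign_char chi -> chi z = 1 ->
  eps (delta_diff z) (eps chi x) = 0.
Proof. by move=> sc cz; rewrite eps_delta (s_eps _ _ sc) cz mulr1z subrr. Qed.

Lemma eps_eps_delta chi z x : sign_char chi -> chi z = 1 ->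
  eps chi (eps (delta_diff z) x) = 0.
Proof.
move=> sc cz; rewrite eps_delta (lin_homB (eps_lin chi)) (eps_s _ _ sc) cz.
by rewrite mulr1z subrr.
Qed.

End IsotypicalSums.

(** * Components and Prym varieties as images *)

Section Isogenies.
Context {R : realType}.
Implicit Types S T : torus R.

(** The isogeny is P itself, restricted to the image of f. *)
Lemma isogenous_range S T (S' : torus R) (f : S' -> S) (P : S -> T) (e : S' -> T) n :
  (0 < n)%N -> lin_hom P -> (forall x, P (f x) = e x) ->
  (forall y, P y = 0 -> y *+ n = 0) -> isogenous (range f) (range e).
Proof.
move=> n0 Plin Pf Pker; exists P; split.
- exact: lin_hom_torus_hom.
- apply/seteqP; split => [_ [_ [x _ <-] <-]|_ [x _ <-]].
    by rewrite Pf; exists x.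
  by exists (f x) => //; exists x.
by apply: (sub_finite_set _ (@torsion_finite _ S n n0)) => y [_ /Pker].
Qed.

Lemma torsion_range0 S T (h : S -> T) n : (0 < n)%N -> lin_hom h ->
  (forall x, h x *+ n = 0) -> forall x, h x = 0.
Proof.
move=> n0 hlin hn x; have [y <-] := torus_divisible x n0.
by rewrite (lin_homMn hlin).
Qed.

End Isogenies.

Section QuotientIsotypical.
Context {R : realType} {gT : finGroupType} (X : curve R) (act : gT -> X -> X).
Hypothesis actX : curve_action act.
Variable JX : jacobian_torus X.
Local Notation sigma g := (Nm JX JX (act g)).
Local Notation Eps := (eps (fun g => sigma g)).

Let s_lin := act_Nm_lin actX JX.
Let sM := act_NmM actX (JX := JX).

Lemma isotypical_linear (rV : mx_representation rat [set: gT]%G 1) (chi : gT -> int)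
    (A : set JX) :
  (forall (m : nat) (c : gT -> int),
     m%:R *: simple_unit rV = \sum_g (c g)%:~R *: regular_repr rat [set: gT]%G g ->
     forall g, #|gT|%:R * c g = m%:R * chi g) ->
  is_isotypical_component act rV A -> A = range (Eps chi).
Proof.
move=> coef [m [c [m0 cE ->]]].
apply: (@range_eps_scale _ _ _ _ s_lin #|gT| m) => //; last exact: coef.
by rewrite -cardsT (cardG_gt0 [set: gT]%G).
Qed.

Lemma isotypical_quaternion (i j : gT) (rW : mx_representation rat [set: gT]%G 4)
    (A : set JX) :
  is_Q8 i j -> is_quaternion_repr i j rW ->
  is_isotypical_component act rW A -> A = range (Eps (delta_diff (i ^+ 2)%g)).
Proof.
move=> Q8 rWE [m [c [m0 cE ->]]].
apply: (@range_eps_scale _ _ _ _ s_lin 2 m) => //; exact: (quaternion_unit_coef Q8 rWE cE).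
Qed.

Section IndexTwo.
Variables (Y XM : curve R) (qY : X -> Y) (k l : gT) (q : X -> XM) (p : XM -> Y).
Hypothesis quoY : is_quotient act [set: gT]%G qY.
Hypothesis quo : is_quotient act <[k]>%G q.
Hypothesis pE : forall x, p (q x) = qY x.
Variables (JY : jacobian_torus Y) (JM : jacobian_torus XM).
Variable chi : gT -> int.
Hypothesis schi : sign_char chi.
Hypothesis kE : forall g, (g \in <[k]>%g) = (chi g == 1).
Hypothesis chil : chi l = -1.

(* l induces the involution of XM over Y. *)
Definition prym_map (x : JX) : JM := Nm JX JM q (x - sigma l x).

Lemma prym_map_lin : lin_hom prym_map.
Proof.
apply: (@lin_hom_comp _ _ _ _ (fun x => x - sigma l x) (Nm JX JM q)).
  by apply: lin_hom_sub; [exact: lin_hom_id|exact: s_lin].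
exact: Nm_lin (quotient_hol_map quo).
Qed.

Lemma pullback_prym_map (P : JM -> JX) :
  (forall x, P (Nm JX JM q x) = \sum_(h in <[k]>%g) sigma h x) ->
  forall x, P (prym_map x) = Eps chi x.
Proof.
move=> PN x; rewrite /prym_map PN /eps (big_sign_char _ schi kE chil).
by apply: eq_bigr => h _; rewrite (lin_homB (s_lin h)) -sM.
Qed.

Lemma prym_pullback : exists P : JM -> JX, [/\ lin_hom P,
  forall x, P (prym_map x) = Eps chi x & forall y, P y = 0 -> y *+ #|<[k]>%g| = 0].
Proof.
have [P [Plin PN NP]] := quotient_pullback quo actX JX JM; exists P; split => //.
- exact: pullback_prym_map.
by move=> y Py; rewrite -NP Py (lin_hom0 (Nm_lin JX JM (quotient_hol_map quo))).
Qed.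

(** With n = |<k>|, a kernel point y satisfies n (2 n) y = [prym_map] (n P y): n^2 comes from q_*
    q^* q_* q^* y, and 2 from eps_1 + eps_chi = 2 q^* q_*. *)
Lemma PrymE : Prym JM JY p = range prym_map.
Proof.
have hq := quotient_hol_map quo; have hqY := quotient_hol_map quoY.
have hp := quotient_hol_factor quo hqY pE.
have [PY [PYlin PYN _]] := quotient_pullback quoY actX JX JY.
have [P [Plin PN NP]] := quotient_pullback quo actX JX JM.
have NN x : Nm JM JY p (Nm JX JM q x) = Nm JX JY qY x by exact: Nm_comp.
pose n := #|<[k]>%g|.
apply: (@component_image _ _ _ _ prym_map _ (n * (2 * n))).
- by rewrite !muln_gt0 cardG_gt0.
- exact: prym_map_lin.
- move=> x; rewrite /prym_map NN (lin_homB (Nm_lin _ _ hqY)).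
  by rewrite (quotient_Nm_act quoY) ?inE // subrr.
move=> y Ny0; exists (P y *+ n).
have Nlin := Nm_lin JX JM hq.
(* The norm of qY kills P y, because p_* q_* q^* y = n p_* y = 0. *)
have eps0 : Eps (fun=> 1) (P y) = 0.
  have : Nm JX JY qY (P y) = 0.
    by rewrite -NN NP (lin_homMn (Nm_lin JM JY hp)) Ny0 mul0rn.
  move=> /(congr1 PY); rewrite PYN (lin_hom0 PYlin) => <-.
  by apply: eq_big => g; rewrite ?inE // mulr1z.
(* Adding eps_1 (P y) = 0 doubles the terms in the kernel of chi and cancels the others. *)
have sum2 : Eps chi (P y) = P (Nm JX JM q (P y)) *+ 2.
  rewrite -[LHS]addr0 -eps0 /eps -big_split /= PN -sumrMnl.
  rewrite [RHS]big_mkcond; apply: eq_bigr => g _; rewrite -mulrzDr kE.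
  by case: schi => _ _ /(_ g)[] ->; rewrite ?mulr0z // -[_ *+ 2]pmulrn.
have := congr1 (Nm JX JM q) sum2.
rewrite -(pullback_prym_map PN) (lin_homMn Nlin) !NP => e.
by rewrite (lin_homMn prym_map_lin) e -!mulrnA mulnA mulnC.
Qed.

End IndexTwo.
End QuotientIsotypical.

Section EpsSquare.
Context {R : realType} {gT : finGroupType} (J : torus R) (s : gT -> J -> J).
Hypothesis s_lin : forall g, lin_hom (s g).
Hypothesis sM : forall g h x, s (g * h)%g x = s g (s h x).
Hypothesis s1 : forall x, s 1%g x = x.

Lemma eps_square chi x : sign_char chi ->
  eps s chi (eps s chi x) = eps s chi x *+ #|gT|.
Proof.
move=> schi; rewrite {2}/eps (lin_hom_big _ _ _ (eps_lin s_lin chi)).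
rewrite -sumr_const; apply: eq_bigr => g _.
rewrite (lin_homMz (eps_lin s_lin chi)) (eps_s sM _ _ schi) -mulrzA.
by have [_ _ /(_ g)[] ->] := schi.
Qed.

Lemma eps_delta_square z x : (z * z = 1)%g ->
  eps s (delta_diff z) (eps s (delta_diff z) x) = eps s (delta_diff z) x *+ 2.
Proof.
move=> zz; rewrite !(eps_delta s1) (lin_homB (s_lin z)) -sM zz s1 mulr2n.
by rewrite !opprB addrA.
Qed.

End EpsSquare.

(** * Gluing the factors into one isogeny *)

Section Splitting.
Context {R : realType} (J : torus R) (n : nat) (n_gt0 : (0 < n)%N).

(* f identifies the image of the quasi-idempotent e with that of f, up to isogeny. *)
Definition splits (T : torus R) (f : J -> T) (e : J -> J) : Prop :=
  [/\ lin_hom f, lin_hom e, forall x, e (e x) = e x *+ n, forall x, f x = 0 -> e x = 0 &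
      exists2 m, (0 < m)%N & forall x, e x = 0 -> f x *+ m = 0].

(** f vanishes on the image of e' and f' on that of e, so e a + e' b has images n f(a) and n f'(b):
    the product of the ranges is reached. If e x + e' x = 0, applying e gives e (n x) = 0, so f x is
    torsion; likewise f' x. *)
Lemma splits_pair (T T' : torus R) (f : J -> T) (f' : J -> T') (e e' : J -> J) :
  splits f e -> splits f' e' -> (forall x, e (e' x) = 0) -> (forall x, e' (e x) = 0) ->
  @splits (prod_torus T T') (fun x => (f x, f' x)) (fun x => e x + e' x) /\
  range (fun x => (f x, f' x)) = range f `*` range f'.
Proof.
move=> sfe sfe' ee' e'e.
(* All g (d' x) are killed by m, so they are 0 by divisibility. *)
have cross (S : torus R) (g : J -> S) (d d' : J -> J) : splits g d -> lin_hom d' ->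
    (forall x, d (d' x) = 0) -> forall x, g (d' x) = 0.
  move=> [glin _ _ _ [m m0 gm]] d'lin dd'.
  apply: (@torsion_range0 _ _ _ (g \o d') m m0); first exact: lin_hom_comp.
  by move=> x; apply: gm.
(* d - n is annihilated by d, so g vanishes on its image. *)
have gd (S : torus R) (g : J -> S) (d : J -> J) : splits g d -> forall x, g (d x) = g x *+ n.
  move=> sgd; have [glin dlin dd _ _] := sgd.
  move=> x; apply/eqP; rewrite -subr_eq0 -(lin_homMn glin) -(lin_homB glin); apply/eqP.
  apply: (cross _ _ _ (fun x => d x - x *+ n) sgd).
    by apply: lin_hom_sub => //; apply: lin_hom_muln; exact: lin_hom_id.
  by move=> y; rewrite (lin_homB dlin) dd (lin_homMn dlin) subrr.
have [flin elin ee fe [m m0 em]] := sfe; have [f'lin e'lin e'e' f'e' [m' m'0 em']] := sfe'.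
have eK (d d' : J -> J) x : lin_hom d -> (forall x, d (d x) = d x *+ n) ->
    (forall x, d (d' x) = 0) ->
    d x + d' x = 0 -> d (x *+ n) = 0.
  move=> dlin dd dd' /(congr1 d); rewrite (lin_homD dlin) dd dd' addr0 (lin_hom0 dlin).
  by rewrite (lin_homMn dlin).
split.
  split.
  - exact: lin_hom_pair.
  - exact: lin_hom_add.
  - by move=> x; rewrite (lin_homD elin) (lin_homD e'lin) ee e'e' ee' e'e addr0 add0r mulrnDl.
  - by move=> x [/fe -> /f'e' ->]; rewrite addr0.
  exists (n * (m * m'))%N; first by rewrite !muln_gt0 n_gt0 m0.
  move=> x ex.
  have h1 : f x *+ (n * (m * m')) = 0.
    by rewrite mulrnA mulrnA -(lin_homMn flin) em ?mul0rn //; exact: eK ex.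
  have h2 : f' x *+ (n * (m * m')) = 0.
    rewrite mulrnA mulnC mulrnA -(lin_homMn f'lin) em' ?mul0rn //.
    by apply: (eK e' e) => //; rewrite addrC.
  have -> : ((f x, f' x) : prod_torus T T') *+ (n * (m * m')) =
     (f x *+ (n * (m * m')), f' x *+ (n * (m * m'))).
    elim: (n * (m * m'))%N => [|k IHk]; first by rewrite !mulr0n.
    by rewrite !mulrS IHk.
  by rewrite h1 h2.
apply/seteqP; split => [_ [x _ <-]|[u v] [[a _ /= <-] [b _ /= <-]]].
  by split; exists x.
have [a' <-] := torus_divisible a n_gt0; have [b' <-] := torus_divisible b n_gt0.
exists (e a' + e' b') => //.
rewrite (lin_homD flin) (lin_homD f'lin) (gd _ _ _ sfe) (gd _ _ _ sfe').
rewrite (cross _ _ _ _ sfe e'lin ee') (cross _ _ _ _ sfe' elin e'e) addr0 add0r.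
by rewrite (lin_homMn flin) (lin_homMn f'lin).
Qed.

Lemma splits_isogenous (T : torus R) (f : J -> T) (e : J -> J) :
  splits f e -> (forall x, e x = x *+ n) -> isogenous [set: J] (range f).
Proof.
move=> [flin elin _ fe _] en; exists f; split => //; first exact: lin_hom_torus_hom.
by apply: (sub_finite_set _ (@torsion_finite _ J n n_gt0)) => x [_ /fe]; rewrite en.
Qed.

End Splitting.

Section Assembly.
Context {R : realType} {gT : finGroupType}.
Context (X : curve R) (act : gT -> X -> X) (actX : curve_action act).
Variable JX : jacobian_torus X.
Local Notation sigma g := (Nm JX JX (act g)).
Local Notation Eps := (eps (fun g => sigma g)).

Lemma splits_char (T : torus R) (f : JX -> T) (P : T -> JX) chi m :
  sign_char chi -> lin_hom f -> lin_hom P -> (forall x, P (f x) = Eps chi x) ->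
  (0 < m)%N -> (forall y, P y = 0 -> y *+ m = 0) -> splits #|gT| f (Eps chi).
Proof.
move=> schi flin Plin Pf m0 Pker; split => //.
- exact: eps_lin (act_Nm_lin actX JX) _.
- by move=> x; exact: (eps_square (act_Nm_lin actX JX) (act_NmM actX (JX := JX))).
- by move=> x fx; rewrite -Pf fx (lin_hom0 Plin).
by exists m => // x; rewrite -Pf => /Pker.
Qed.

Section QuotientCurve.
Variables (Y : curve R) (qY : X -> Y) (JY : jacobian_torus Y).
Hypothesis quoY : is_quotient act [set: gT]%G qY.

Lemma quotient_pullback_eps : exists P : JY -> JX, [/\ lin_hom P,
  forall x, P (Nm JX JY qY x) = Eps (fun=> 1) x & forall y, P y = 0 -> y *+ #|gT| = 0].
Proof.
have [P [Plin PN NP]] := quotient_pullback quoY actX JX JY; exists P; split => //.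
  by move=> x; rewrite PN; apply: eq_big => g; rewrite ?inE // mulr1z.
move=> y Py; rewrite -cardsT -NP Py (lin_hom0 (Nm_lin _ _ (quotient_hol_map quoY))).
by [].
Qed.

Lemma quotient_Nm_surj : range (Nm JX JY qY) = [set: JY].
Proof.
have [P [_ _ NP]] := quotient_pullback quoY actX JX JY.
apply/seteqP; split => // y _; have [y' <-] := torus_divisible y (cardG_gt0 [set: gT]%G).
by exists (P y') => //; rewrite NP.
Qed.

End QuotientCurve.

(** Since q^* q_* = 1 + s_z, a point y of the kernel has s_z y = - y, whence 2 y = (1 - s_z) y. *)
Lemma Prym_involution (Xm : curve R) (z : gT) (qm : X -> Xm) (JXm : jacobian_torus Xm) :
  is_quotient act <[z]>%G qm -> (z * z = 1)%g -> z != 1%g ->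
  Prym JX JXm qm = range (Eps (delta_diff z)).
Proof.
move=> quom zz z1; have hq := quotient_hol_map quom.
have [P [Plin PN _]] := quotient_pullback quom actX JX JXm.
apply: (@component_image _ _ _ _ _ _ 2) => //.
- exact: eps_lin (act_Nm_lin actX JX) _.
- move=> x; rewrite (eps_delta (act_Nm1 actX (JX := JX))) (lin_homB (Nm_lin _ _ hq)).
  by rewrite (quotient_Nm_act quom) ?cycle_id // subrr.
move=> y Ny; exists y; rewrite (eps_delta (act_Nm1 actX (JX := JX))).
have : y + sigma z y = 0.
  have := PN y; rewrite Ny (lin_hom0 Plin) /= => ->.
  rewrite (bigD1 1%g) ?group1 //= (act_Nm1 actX); congr (_ + _).
  rewrite (big_pred1 z) // => g; apply/andP/eqP => [[/cycleP[n ->] gn1]|->]; last first.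
    by rewrite cycle_id.
  move: gn1; rewrite -[n]odd_double_half expgD -muln2 mulnC expgM.
  have -> : (z ^+ 2 = 1)%g by rewrite expgS expg1.
  by rewrite expg1n mulg1; case: (odd n); rewrite ?eqxx.
by move=> /eqP; rewrite addrC addr_eq0 => /eqP ->; rewrite opprK mulr2n.
Qed.

End Assembly.

Theorem proposition5p2 (R : realType) (gT : finGroupType) (i j : gT)
  (Q8 : is_Q8 i j)
  (X : curve R) (g : nat) (gX : genus X g) (g_ge2 : (2 <= g)%N)
  (act : gT -> X -> X) (actX : curve_action act)
  (Y Xi Xj Xij Xm : curve R)
  (qY : X -> Y) (qi : X -> Xi) (qj : X -> Xj) (qij : X -> Xij) (qm : X -> Xm)
  (quoY : is_quotient act [set: gT]%G qY)
  (quoi : is_quotient act <[i]>%G qi)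
  (quoj : is_quotient act <[j]>%G qj)
  (quoij : is_quotient act <[i * j]>%G qij)
  (quom : is_quotient act <[i ^+ 2]>%G qm)
  (pi : Xi -> Y) (pj : Xj -> Y) (pij : Xij -> Y)
  (piE : forall x, pi (qi x) = qY x)
  (pjE : forall x, pj (qj x) = qY x)
  (pijE : forall x, pij (qij x) = qY x)
  (JX : jacobian_torus X) (JY : jacobian_torus Y)
  (JXi : jacobian_torus Xi) (JXj : jacobian_torus Xj) (JXij : jacobian_torus Xij)
  (JXm : jacobian_torus Xm)
  (rU rUi rUj rUij : mx_representation rat [set: gT]%G 1)
  (rW : mx_representation rat [set: gT]%G 4)
  (rUE : is_character i j rU 1 1)
  (rUiE : is_character i j rUi 1 (-1))
  (rUjE : is_character i j rUj (-1) 1)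
  (rUijE : is_character i j rUij (-1) (-1))
  (rWE : is_quaternion_repr i j rW)
  (AU AUi AUj AUij AW : set JX)
  (AUE : is_isotypical_component act rU AU)
  (AUiE : is_isotypical_component act rUi AUi)
  (AUjE : is_isotypical_component act rUj AUj)
  (AUijE : is_isotypical_component act rUij AUij)
  (AWE : is_isotypical_component act rW AW) :
  [/\ @isogenous R JX
        (prod_torus (prod_torus (prod_torus (prod_torus JY JXi) JXj) JXij) JX)
        [set: JX]
        ([set: JY] `*` Prym JXi JY pi `*` Prym JXj JY pj `*` Prym JXij JY pij
           `*` Prym JX JXm qm)
    & [/\ isogenous [set: JY] AU,
          isogenous (Prym JXi JY pi) AUi,
          isogenous (Prym JXj JY pj) AUj,
          isogenous (Prym JXij JY pij) AUij &
          isogenous (Prym JX JXm qm) AW]].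
Proof.
have s_lin := act_Nm_lin actX JX.
have sM := act_NmM actX (JX := JX).
have s1 := act_Nm1 actX (JX := JX).
pose z := (i ^+ 2)%g.
have zz : (z * z = 1)%g := Q8_z2 Q8.
have z1 : z != 1%g := z_neq1 rWE.
have n8 : #|gT| = 8 by case: Q8.
have n0 : (0 < #|gT|)%N by rewrite n8.
have pm1 : (1 : int) = 1 \/ (1 : int) = -1 by left.
have mp1 : (-1 : int) = 1 \/ (-1 : int) = -1 by right.
have cU : is_character i j rU (1 : int)%:~R (1 : int)%:~R by [].
have ci : is_character i j rUi (1 : int)%:~R (-1 : int)%:~R by rewrite rmorphN1.
have cj : is_character i j rUj (-1 : int)%:~R (1 : int)%:~R by rewrite rmorphN1.
have cij : is_character i j rUij (-1 : int)%:~R (-1 : int)%:~R by rewrite rmorphN1.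
have AUi' := isotypical_linear actX (char_unit_coef Q8 ci pm1 mp1) AUiE.
have AUj' := isotypical_linear actX (char_unit_coef Q8 cj mp1 pm1) AUjE.
have AUij' := isotypical_linear actX (char_unit_coef Q8 cij mp1 mp1) AUijE.
have AU' := isotypical_linear actX (char_unit_coef Q8 cU pm1 pm1) AUE.
have AW' := isotypical_quaternion actX Q8 rWE AWE.
have sU := char_of_sign Q8 cU pm1 pm1; have si := char_of_sign Q8 ci pm1 mp1.
have sj := char_of_sign Q8 cj mp1 pm1; have sij := char_of_sign Q8 cij mp1 mp1.
have Ui := char_ofi Q8 cU pm1 pm1; have Uj := char_ofj Q8 cU pm1 pm1.
have ii := char_ofi Q8 ci pm1 mp1; have ij := char_ofj Q8 ci pm1 mp1.
have ji := char_ofi Q8 cj mp1 pm1; have jj := char_ofj Q8 cj mp1 pm1.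
have iji := char_ofi Q8 cij mp1 mp1; have ijj := char_ofj Q8 cij mp1 mp1.
have U1 : char_of rU =1 (fun=> 1).
  case: (sU) => chiM chi1 _ h; have [c [x [y ->]]] := Q8_enum Q8 h.
  have chiX k (b : bool) : char_of rU k = 1 -> char_of rU (k ^+ b)%g = 1 by case: b.
  by rewrite !chiM !chiX ?mul1r // expgS expg1 chiM Ui.
have char_z chi : sign_char chi -> chi z = 1.
  by move=> [chiM _ chiS]; rewrite /z expgS expg1 chiM; case: (chiS i) => ->.
set chii := char_of rUi in AUi' si ii ij *.
set chij := char_of rUj in AUj' sj ji jj *.
set chiij := char_of rUij in AUij' sij iji ijj *.
pose one_char (_ : gT) : int := 1.
have s0 : sign_char one_char by split => // g; left.
rewrite (_ : eps _ (char_of rU) = eps (fun g => Nm JX JX (act g)) one_char) in AU'; last first.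
  by apply/funext => x; exact: eps_eq.
pose E chi := eps (fun g => Nm JX JX (act g)) chi.
have kE_i : forall g, (g \in <[i]>%g) = (chii g == 1)
  by case: (cycle_ker Q8 si) => h _ _; exact: h.
have kE_j : forall g, (g \in <[j]>%g) = (chij g == 1)
  by case: (cycle_ker Q8 sj) => _ h _; exact: h.
have kE_ij : forall g, (g \in <[i * j]>%g) = (chiij g == 1)
  by case: (cycle_ker Q8 sij) => _ _ h; exact: h.
have [P0 [P0lin P0f P0ker]] := quotient_pullback_eps actX JX JY quoY.
(* The element l outside the kernel is j for <i>, and i for <j> and <ij>. *)
have [Pi [Pilin Pif Piker]] := prym_pullback actX JX quoi JXi si kE_i ij.
have [Pj [Pjlin Pjf Pjker]] := prym_pullback actX JX quoj JXj sj kE_j ji.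
have [Pij [Pijlin Pijf Pijker]] := prym_pullback actX JX quoij JXij sij kE_ij iji.
have ri := PrymE actX JX quoY quoi piE JY JXi si kE_i ij.
have rj := PrymE actX JX quoY quoj pjE JY JXj sj kE_j ji.
have rij := PrymE actX JX quoY quoij pijE JY JXij sij kE_ij iji.
have rm := Prym_involution actX JX JXm quom zz z1.
have r0 := quotient_Nm_surj actX JX JY quoY.

split; last first.
  rewrite ri rj rij rm -r0 AU' AUi' AUj' AUij' AW'; split.
  - exact: (isogenous_range n0 P0lin P0f P0ker).
  - exact: (isogenous_range (cardG_gt0 _) Pilin Pif Piker).
  - exact: (isogenous_range (cardG_gt0 _) Pjlin Pjf Pjker).
  - exact: (isogenous_range (cardG_gt0 _) Pijlin Pijf Pijker).
  (* The Prym variety and A_W are equal, both being the image of 1 - s_z. *)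
  exact: (@isogenous_range _ _ _ _ _ id _ 1 _ (@lin_hom_id _ _)).
have S0 : splits _ _ (E _) :=
  splits_char actX s0 (Nm_lin JX JY (quotient_hol_map quoY)) P0lin P0f n0 P0ker.
have Si : splits _ _ (E _) :=
  splits_char actX si (prym_map_lin actX JX j quoi JXi) Pilin Pif (cardG_gt0 _) Piker.
have Sj : splits _ _ (E _) :=
  splits_char actX sj (prym_map_lin actX JX i quoj JXj) Pjlin Pjf (cardG_gt0 _) Pjker.
have Sij : splits _ _ (E _) :=
  splits_char actX sij (prym_map_lin actX JX i quoij JXij) Pijlin Pijf (cardG_gt0 _) Pijker.
have Elin chi : lin_hom (E chi) := eps_lin s_lin chi.
(* The map to the last factor is 1 - s_z itself. Only e carries the 4: as (1 - s_z)^2 = 2 (1 - s_z),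
   it has e^2 = 8 e like the others. *)
pose D := delta_diff z; pose e4 x := E D x *+ 4.
have DD x : E D (E D x) = E D x *+ 2 by apply: eps_delta_square.
have S4 : splits #|gT| (E D) e4.
  split=> //.
  - by apply: (@lin_hom_comp _ _ _ _ (E D) (fun y => y *+ 4)) => //;
      apply: lin_hom_muln; exact: lin_hom_id.
  - move=> x; rewrite /e4 (lin_homMn (Elin D)) DD n8.
    by rewrite -!mulrnA.
  - by move=> x Dx; rewrite /e4 Dx mul0rn.
  by exists 4.
have orth chi psi l : sign_char chi -> sign_char psi -> chi l * psi l = -1 ->
    (forall x, E chi (E psi x) = 0) /\ (forall x, E psi (E chi x) = 0).
  move=> sc sp cp; split=> x; first exact: (eps_orth s_lin sM _ sc sp cp).
  by apply: (eps_orth s_lin sM _ sp sc (l := l)); rewrite mulrC.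
have orthD chi : sign_char chi ->
    (forall x, E chi (e4 x) = 0) /\ (forall x, e4 (E chi x) = 0).
  move=> sc; have cz := char_z _ sc.
  have ED x : E chi (E D x) = 0 by apply: eps_eps_delta.
  have DE x : E D (E chi x) = 0 by apply: eps_delta_eps.
  by split=> x; rewrite /e4 ?(lin_homMn (Elin chi)) ?ED ?DE mul0rn.
(* Two distinct sign characters differ at i or j, where their product is -1. *)
have /(orth _ _ _ s0 si)[oui oiu] : one_char j * chii j = -1 by rewrite ij.
have /(orth _ _ _ s0 sj)[ouj oju] : one_char i * chij i = -1 by rewrite ji.
have /(orth _ _ _ s0 sij)[ouk oku] : one_char i * chiij i = -1 by rewrite iji.
have /(orth _ _ _ si sj)[oij oji] : chii i * chij i = -1 by rewrite ii ji.
have /(orth _ _ _ si sij)[oik oki] : chii i * chiij i = -1 by rewrite ii iji.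
have /(orth _ _ _ sj sij)[ojk okj] : chij j * chiij j = -1 by rewrite jj ijj.
have [ouD oDu] := orthD _ s0; have [oiD oDi] := orthD _ si.
have [ojD oDj] := orthD _ sj; have [okD oDk] := orthD _ sij.
have [T1 t1] := splits_pair n0 S0 Si oui oiu.
have [||T2 t2] := splits_pair n0 T1 Sj.
- by move=> x; rewrite ouj oij addr0.
- by move=> x; rewrite (lin_homD (Elin chij)) oju oji addr0.
have [||T3 t3] := splits_pair n0 T2 Sij.
- by move=> x; rewrite ouk oik ojk !addr0.
- by move=> x; rewrite !(lin_homD (Elin chiij)) oku oki okj !addr0.
have [_ e4lin _ _ _] := S4.
have [||T4 t4] := splits_pair n0 T3 S4.
- by move=> x; rewrite ouD oiD ojD okD !addr0.
- by move=> x; rewrite !(lin_homD e4lin) oDu oDi oDj oDk !addr0.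
have := splits_isogenous n0 T4.
rewrite t4 t3 t2 t1 r0 -ri -rj -rij -rm; apply=> x.
(* The sum of the five operators is compared with 8 coefficient by coefficient in s_h x, using
   [quaternion_sum]. *)
rewrite /e4 /E /eps -sumrMnl -!big_split /= n8.
rewrite (eq_bigr (fun h => Nm JX JX (act h) x *~ (8 * (h == 1%g)%:R))) => [|h _].
  rewrite (bigD1 1%g) //= eqxx s1 big1 ?addr0 // => h /negbTE ->.
  by rewrite mulr0 mulr0z.
rewrite -(quaternion_sum Q8 rWE si sj sij) // !mulrzDr; congr (_ + _).
by rewrite -mulrzDr [4 * _]mulrC mulrzA.
Qed.
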